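(* Let $n \geq 2$, let $X$ be a complex manifold of dimension $n$, and let $F: X \to \mathbb{C}^n$ be a local biholomorphism. If for every complex line $l \subset \mathbb{C}^n$ with $F^{-1}(l) \neq \emptyset$ the pre-image $F^{-1}(l)$ is connected and conformal to $\mathbb{C}$, then $F$ is injective.
   Context: A complex line in $\mathbb{C}^n$ is an affine complex line (a translate of a one-dimensional complex linear subspace). Since $F$ is a local biholomorphism, each non-empty pre-image $F^{-1}(l)$ is a one-dimensional complex submanifold of $X$; ''conformal to $\mathbb{C}$'' means biholomorphic to $\mathbb{C}$ for this induced complex structure. *)

(* Defs.v *)
From HB Require Import structures.
From mathcomp Require Import all_boot all_order all_algebra.
From mathcomp Require Import complex.
From mathcomp Require Import all_classical all_reals.
From mathcomp Require Import topology normedtype landau derive.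

Set Implicit Arguments.
Unset Strict Implicit.
Unset Printing Implicit Defensive.

Import Order.TTheory GRing.Theory Num.Theory.
Import numFieldNormedType.Exports.

Local Open Scope classical_set_scope.
Local Open Scope ring_scope.

Section Differentiable.
Variable K : numFieldType.

Lemma near_eq_differentiable (V W : normedModType K) (f g : V -> W) (x : V) :
  (\near x, f x = g x) -> differentiable f x -> differentiable g x.
Proof.
move=> fg df.
have fgx : f x = g x by exact: nbhs_singleton fg.
have cdf := diff_continuous df.
have dg : g \o shift x = cst (g x) + 'd f x +o_ 0 id.
  apply/eqaddoP => e e0.
  have /eqaddoP/(_ _ e0) := diff_locally df; apply: filter_app.
  have : \forall h \near 0, f (h + x) = g (h + x).
    have := fg; rewrite (near_shift 0) => fg0.
    by apply: filterS fg0 => h /=; rewrite subr0.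
  apply: filterS => h fgh /=.
  by rewrite !fctE /= fgh fgx.
by apply/diff_locallyP; rewrite (diff_unique cdf dg).
Qed.

Lemma differentiable_mulmxr m n (A : 'M[K]_(m, n)) (z : 'rV[K]_m) :
  differentiable (fun w : 'rV[K]_m => w *m A) z.
Proof.
rewrite (_ : (fun _ => _) =
    \sum_(i < m) (fun w : 'rV[K]_m => w ord0 i *: row i A)); last first.
  by apply/funext => w; rewrite mulmx_sum_row fct_sumE.
apply: differentiable_sum => i.
apply: differentiableZl; exact: differentiable_coord.
Qed.

End Differentiable.

(* The library puts a topology on abstract numeric fields only; as there, a field
   is normed as a module over itself. *)
Section ComplexTopology.
Variable R : rcfType.
HB.instance Definition _ := GRing.ComAlgebra.copy R[i] R[i]^o.
HB.instance Definition _ := Vector.copy R[i] R[i]^o.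
HB.instance Definition _ := NormedModule.copy R[i] R[i]^o.
End ComplexTopology.

Section ComplexManifolds.
Variable R : realType.
Local Notation C := R[i].

Record chart (X : topologicalType) (n : nat) := Chart {
  chart_dom : set X;
  chart_cod : set 'rV[C]_n;
  chart_map :> X -> 'rV[C]_n;
  (* Only meaningful on [chart_cod]. *)
  chart_inv : 'rV[C]_n -> X;
  chart_dom_open : open chart_dom;
  chart_cod_open : open chart_cod;
  chart_map_cod : forall x, chart_dom x -> chart_cod (chart_map x);
  chart_inv_dom : forall z, chart_cod z -> chart_dom (chart_inv z);
  chart_mapK : forall x, chart_dom x -> chart_inv (chart_map x) = x;
  chart_invK : forall z, chart_cod z -> chart_map (chart_inv z) = z;
  chart_map_cont : forall x, chart_dom x -> {for x, continuous chart_map};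
  chart_inv_cont : forall z, chart_cod z -> {for z, continuous chart_inv}
}.

(* The transition map [d \o c^-1] is holomorphic, i.e. complex differentiable
   at every point of the open set [c (chart_dom c `&` chart_dom d)]. *)
Definition holomorphic_transition (X : topologicalType) n (c d : chart X n) :=
  forall z, chart_cod c z -> chart_dom d (chart_inv c z) ->
    differentiable (d \o chart_inv c) z.

Record complex_structure (X : topologicalType) (n : nat) := ComplexStructure {
  atlas : set (chart X n);
  atlas_cover : forall x, exists2 c, atlas c & chart_dom c x;
  atlas_transition : forall c d, atlas c -> atlas d ->
    holomorphic_transition c d
}.

Record complex_manifold (n : nat) := ComplexManifold {
  manifold_space :> topologicalType;
  manifold_hausdorff : hausdorff_space manifold_space;
  manifold_second_countable : @second_countable manifold_space;
  manifold_structure :> complex_structure manifold_space n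
}.

(* The atlas of a [complex_structure] need not be maximal. *)
Definition maximal_atlas (X : topologicalType) n (A : complex_structure X n) :
    set (chart X n) :=
  [set c | forall d, atlas A d ->
    holomorphic_transition c d /\ holomorphic_transition d c].

Definition holomorphic_on (X Y : topologicalType) m n
    (A : complex_structure X m) (B : complex_structure Y n)
    (U : set X) (f : X -> Y) :=
  forall x, U x -> {for x, continuous f} /\
    forall c d, atlas A c -> atlas B d -> chart_dom c x -> chart_dom d (f x) ->
      differentiable (d \o f \o chart_inv c) (c x).

Definition biholomorphic (X Y : topologicalType) m n
    (A : complex_structure X m) (B : complex_structure Y n) :=
  exists (f : X -> Y) (g : Y -> X),
    [/\ cancel f g, cancel g f,
        holomorphic_on A B setT f & holomorphic_on B A setT g].

Definition local_biholomorphism (X Y : topologicalType) n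
    (A : complex_structure X n) (B : complex_structure Y n) (f : X -> Y) :=
  forall x, exists (U : set X) (g : Y -> X),
    [/\ open U, U x & open (f @` U)] /\
    [/\ {in U, cancel f g}, holomorphic_on A B U f &
        holomorphic_on B A (f @` U) g].

Section StandardStructure.
Variable n : nat.

Definition standard_chart : chart 'rV[C]_n n :=
  @Chart 'rV[C]_n n setT setT id id openT openT
    (fun _ _ => I) (fun _ _ => I) (fun _ _ => erefl) (fun _ _ => erefl)
    (fun z _ => @cvg_id _ (nbhs z)) (fun z _ => @cvg_id _ (nbhs z)).

Lemma standard_atlas_cover (z : 'rV[C]_n) :
  exists2 c, [set standard_chart] c & chart_dom c z.
Proof. by exists standard_chart. Qed.

Lemma standard_atlas_transition (c d : chart 'rV[C]_n n) :
  [set standard_chart] c -> [set standard_chart] d ->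
  holomorphic_transition c d.
Proof. by move=> -> -> z _ _; exact: (@ex_diff _ _ _ _ _ _ _ (is_diff_id z)). Qed.

Definition complex_space : complex_structure 'rV[C]_n n :=
  ComplexStructure standard_atlas_cover standard_atlas_transition.

End StandardStructure.

Section Submanifold.
Variables (X : topologicalType) (n : nat) (A : complex_structure X n).
Variables (k : nat) (S : set X).

(* [w *m pid_mx k] is [w] padded with zeros, so the condition says that [c]
   maps [S] within its domain to the slice C^k x {0} of C^n. *)
Definition slice_chart (c : chart X n) :=
  forall x, chart_dom c x ->
    S x <-> exists w : 'rV[C]_k, c x = w *m (pid_mx k : 'M_(k, n)).

Definition complex_submanifold :=
  (k <= n)%N /\
  forall x, S x -> exists c, [/\ maximal_atlas A c, slice_chart c & chart_dom c x].

(* The charts of [S], with its subspace topology, that consist of the first [k]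
   coordinates of a slice chart. *)
Definition induced_chart (c : chart X n) (e : chart S k) :=
  chart_dom e = set_val @^-1` chart_dom c /\
  forall s : S, chart_dom e s ->
    c (set_val s) = e s *m (pid_mx k : 'M_(k, n)).

Definition induced_atlas : set (chart S k) :=
  [set e | exists c, [/\ maximal_atlas A c, slice_chart c & induced_chart c e]].

Hypothesis S_sub : complex_submanifold.

Lemma pid_mxK (w : 'rV[C]_k) :
  w *m (pid_mx k : 'M_(k, n)) *m (pid_mx k : 'M_(n, k)) = w.
Proof.
have [kn _] := S_sub.
by rewrite -mulmxA mul_pid_mx minnn (minn_idPr kn) pid_mx_1 mulmx1.
Qed.

Lemma maximal_atlas_transition (c d : chart X n) :
  maximal_atlas A c -> maximal_atlas A d -> holomorphic_transition c d.
Proof.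
move=> Ac Ad z cz dz.
have [b Ab bz] := atlas_cover A (chart_inv c z).
have [cb _] := Ac _ Ab; have [_ bd] := Ad _ Ab.
apply: (@near_eq_differentiable _ _ _
    ((d \o chart_inv b) \o (b \o chart_inv c))).
  have : \forall w \near z, chart_dom b (chart_inv c w).
    apply: (chart_inv_cont cz).
    by apply: open_nbhs_nbhs; split => //; exact: chart_dom_open.
  by apply: filterS => w bw /=; rewrite chart_mapK.
apply: differentiable_comp; first exact: cb.
by apply: bd; rewrite /= ?chart_mapK//; exact: chart_map_cod.
Qed.

Lemma induced_invE (c : chart X n) (e : chart S k) (z : 'rV[C]_k) :
  induced_chart c e -> chart_cod e z ->
  chart_cod c (z *m (pid_mx k : 'M_(k, n))) /\
  set_val (chart_inv e z) = chart_inv c (z *m (pid_mx k : 'M_(k, n))).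
Proof.
move=> [domE mapE] ez.
have es := chart_inv_dom ez.
have := mapE _ es; rewrite chart_invK// => <-.
have cs : chart_dom c (set_val (chart_inv e z)) by move: es; rewrite domE.
by rewrite chart_mapK//; split => //; exact: chart_map_cod.
Qed.

Lemma induced_atlas_transition (e1 e2 : chart S k) :
  induced_atlas e1 -> induced_atlas e2 -> holomorphic_transition e1 e2.
Proof.
move=> [c1 [A1 _ I1]] [c2 [A2 _ I2]] z ez1 ez2.
pose up (w : 'rV[C]_k) := w *m (pid_mx k : 'M_(k, n)).
pose down (w : 'rV[C]_n) := w *m (pid_mx k : 'M_(n, k)).
apply: (@near_eq_differentiable _ _ _ (down \o ((c2 \o chart_inv c1) \o up))).
  have n2 : \forall w \near z, chart_dom e2 (chart_inv e1 w).
    apply: (chart_inv_cont ez1).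
    by apply: open_nbhs_nbhs; split => //; exact: chart_dom_open.
  have n1 : \forall w \near z, chart_cod e1 w.
    by apply: open_nbhs_nbhs; split => //; exact: chart_cod_open.
  apply: filterS2 n1 n2 => w w1 w2 /=.
  have [_ <-] := induced_invE I1 w1.
  by rewrite (I2.2 _ w2) /down pid_mxK.
have [cz1 cz2] := induced_invE I1 ez1.
apply: differentiable_comp; last exact: differentiable_mulmxr.
apply: differentiable_comp; first exact: differentiable_mulmxr.
apply: maximal_atlas_transition => //=.
rewrite /up -cz2.
by move: ez2; rewrite I2.1.
Qed.

Lemma induced_chart_exists (c : chart X n) (s0 : S) :
  slice_chart c -> exists e : chart S k, induced_chart c e.
Proof.
move=> Sc.
pose up (w : 'rV[C]_k) := w *m (pid_mx k : 'M_(k, n)).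
pose down (w : 'rV[C]_n) := w *m (pid_mx k : 'M_(n, k)).
have upK w : down (up w) = w by exact: pid_mxK.
have up_cont : continuous up.
  by move=> w; apply: differentiable_continuous; exact: differentiable_mulmxr.
have down_cont : continuous down.
  by move=> w; apply: differentiable_continuous; exact: differentiable_mulmxr.
have val_cont : continuous (set_val : S -> X) by exact: initial_continuous.
pose dom : set S := set_val @^-1` chart_dom c.
pose cod : set 'rV[C]_k := up @^-1` chart_cod c.
pose f (s : S) := down (c (set_val s)).
pose g (w : 'rV[C]_k) : S := insubd s0 (chart_inv c (up w)).
have gE w : cod w -> set_val (g w) = chart_inv c (up w).
  move=> cw; rewrite set_valE /= insubdK// inE.
  apply/(Sc _ (chart_inv_dom cw)); exists w.
  by rewrite chart_invK.
have fE s : dom s -> c (set_val s) = up (f s).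
  move=> ds; have [w cw] := (Sc _ ds).1 (set_valP s).
  by move: cw; rewrite set_valE /= /f set_valE /= => ->; rewrite upK.
have dom_open : open dom.
  by apply: open_comp => [? _|]; [exact: val_cont|exact: chart_dom_open].
have cod_open : open cod.
  by apply: open_comp => [? _|]; [exact: up_cont|exact: chart_cod_open].
have f_cod s : dom s -> cod (f s).
  by move=> ds; rewrite /cod /= -fE//; exact: chart_map_cod.
have g_dom w : cod w -> dom (g w).
  by move=> cw; rewrite /dom /= gE//; exact: chart_inv_dom.
have fK s : dom s -> g (f s) = s.
  move=> ds; apply: val_inj; rewrite -!set_valE.
  by rewrite gE -?fE ?chart_mapK//; exact: f_cod.
have gK w : cod w -> f (g w) = w.
  by move=> cw; rewrite /f gE// chart_invK// upK.
have f_cont s : dom s -> {for s, continuous f}.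
  move=> ds; apply: continuous_comp; last exact: down_cont.
  apply: continuous_comp; first exact: val_cont.
  exact: chart_map_cont.
have g_cont w : cod w -> {for w, continuous g}.
  move=> cw U [_ [[V oV <-] /= Vgw VU]].
  have nV : \forall y \near w, V (chart_inv c (up y)).
    apply: (up_cont w (fun z => V (chart_inv c z))).
    apply: (chart_inv_cont (cw : chart_cod c (up w))).
    by apply: open_nbhs_nbhs; split => //; rewrite -gE.
  have nc : \forall y \near w, cod y by apply: open_nbhs_nbhs; split.
  by apply: filterS2 nV nc => y Vy cy; apply: VU; rewrite /= gE.
exists (Chart dom_open cod_open f_cod g_dom fK gK f_cont g_cont).
by split.
Qed.

Lemma induced_atlas_cover (s : S) :
  exists2 e, induced_atlas e & chart_dom e s.
Proof.
have [c [Ac Sc cs]] := S_sub.2 _ (set_valP s).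
have [e ce] := induced_chart_exists s Sc.
exists e; first by exists c.
by rewrite ce.1.
Qed.

Definition submanifold_structure : complex_structure S k :=
  ComplexStructure induced_atlas_cover induced_atlas_transition.

End Submanifold.

Definition complex_line n (l : set 'rV[C]_n) :=
  exists p v : 'rV[C]_n, v != 0 /\ l = [set p + t *: v | t in [set: C]].

Lemma complex_line_slice n (l : set 'rV[C]_n) : complex_line l ->
  exists (p : 'rV[C]_n) (B : 'M[C]_n), B \in unitmx /\ forall z, l z <->
    exists w : 'rV[C]_1, (z - p) *m invmx B = w *m (pid_mx 1 : 'M_(1, n)).
Proof.
move=> [p [v [v0 ->]]]; exists p, (row_ebase v); split.
  exact: row_ebase_unit.
have vE : v = col_ebase v *m pid_mx 1 *m row_ebase v.
  by rewrite -[LHS]mulmx_ebase rank_rV v0.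
have Bu := row_ebase_unit v.
have : col_ebase v \in unitmx by exact: col_ebase_unit.
move=> cu z; split.
  move=> [t _ <-]; exists (t *: col_ebase v).
  rewrite addrAC subrr add0r -scalemxAl {1}vE mulmxK//.
  by rewrite -scalemxAl.
move=> [w wE]; exists ((w *m invmx (col_ebase v)) 0 0) => //.
rewrite -mul_scalar_mx -mx11_scalar {2}vE !mulmxA mulmxKV// -wE mulmxKV//.
by rewrite addrC subrK.
Qed.

Lemma preimage_line_submanifold (X : topologicalType) n
    (A : complex_structure X n) (F : X -> 'rV[C]_n) (l : set 'rV[C]_n) :
  local_biholomorphism A (complex_space n) F -> complex_line l ->
  complex_submanifold A 1 (F @^-1` l).
Proof.
move=> hF hl; split.
  have [p [v [v0 _]]] := hl.
  by rewrite lt0n; apply: contraNneq v0 => n0; move: v; rewrite n0 => v; rewrite thinmx0.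
have [p [B [Bu lE]]] := complex_line_slice hl.
move=> x0 lx0.
have [U [g [[oU Ux0 oFU] [FK hFU hgU]]]] := hF x0.
pose T z := (z - p) *m invmx B.
pose Ti w := w *m B + p.
have TK z : Ti (T z) = z by rewrite /T /Ti mulmxKV// subrK.
have TiK w : T (Ti w) = w by rewrite /T /Ti addrK mulmxK.
have dT z : differentiable T z.
  apply: (@differentiable_comp _ _ _ _ (fun z => z - p)
    (fun z => z *m invmx B)); last exact: differentiable_mulmxr.
  by apply: differentiableB.
have dTi z : differentiable Ti z.
  by apply: differentiableD => //; exact: differentiable_mulmxr.
have cT z : {for z, continuous T} by exact: differentiable_continuous.
have cTi z : {for z, continuous Ti} by exact: differentiable_continuous.
have gK x : U x -> g (F x) = x by move=> Ux; apply: FK; rewrite inE.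
pose cod : set 'rV[C]_n := Ti @^-1` (F @` U).
have cod_open : open cod by apply: open_comp => // w _; exact: cTi.
have f_cod x : U x -> cod (T (F x)).
  by move=> Ux; rewrite /cod /= TK; exists x.
have g_dom w : cod w -> U (g (Ti w)).
  by move=> [x Ux xE]; rewrite -xE gK.
have fK x : U x -> g (Ti (T (F x))) = x by move=> Ux; rewrite TK gK.
have fgK w : cod w -> T (F (g (Ti w))) = w.
  by move=> [x Ux xE]; rewrite -xE gK// xE TiK.
have f_cont x : U x -> {for x, continuous (T \o F)}.
  by move=> Ux; apply: continuous_comp; [exact: (hFU _ Ux).1|exact: cT].
have g_cont w : cod w -> {for w, continuous (g \o Ti)}.
  by move=> cw; apply: continuous_comp; [exact: cTi|exact: (hgU _ cw).1].
pose c := Chart oU cod_open f_cod g_dom fK fgK f_cont g_cont.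
exists c; split; [|by move=> x Ux; exact: (lE (F x))|exact: Ux0].
move=> d Ad; split => [w cw dw|z dz Uz] /=.
- apply: (@differentiable_comp _ _ _ _ Ti (d \o g)); first exact: dTi.
  by have [_ /(_ (standard_chart n) d erefl Ad I dw)] := hgU _ cw.
- apply: (@differentiable_comp _ _ _ _ (F \o chart_inv d) T); last exact: dT.
  have [_ /(_ d (standard_chart n) Ad erefl (chart_inv_dom dz) I)] :=
    hFU _ Uz.
  by rewrite (chart_invK dz).
Qed.

End ComplexManifolds.

(* Main.v *)
Require Import Defs.
From mathcomp Require Import all_boot all_order all_algebra finmap.
From mathcomp Require Import ring lra.
From mathcomp Require Import complex.
From mathcomp Require Import all_classical all_reals.
From mathcomp Require Import topology normedtype derive.

(* Suppose F a = F b with a <> b. Over each direction v <> 0, the preimage of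
   the line through F a carries a coordinate c_v onto C with c_v a = 0,
   normalized by F = F a + (c_v + o(c_v)) v at a; put tau v := c_v b, which is
   not 0. Since F is a local homeomorphism, a large compact disc of the fiber
   over v lifts to the fiber over any nearby direction v', and the quotient of
   the coordinate c_v' by the coordinate c_v has no zero on this disc, so it has
   a square root there equal to 1 at a. Evaluating it at b carries square roots
   of tau v to square roots of tau v', although nothing says that tau is
   continuous. This transport is locally consistent, hence consistent over any
   disc of directions. The directions max(0, 1 - |p|) e_0 + p e_1, up to a factor
   2 on e_0, are parametrized by a disc, and for |p| >= 1 they lie on one line,
   where tau is a constant times 1/p: one gets a continuous square root of 1/p
   around a loop winding once about 0, which is absurd. *)

Set Implicit Arguments.
Unset Strict Implicit.
Unset Printing Implicit Defensive.

Import Order.TTheory GRing.Theory Num.Theory numFieldNormedType.Exports.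

Local Open Scope classical_set_scope.
Local Open Scope ring_scope.

(** * Local constancy and monodromy *)

(** Connectedness of [0, 1]: inside it [P] agrees both with its interior and with the complement of
    the interior of its negation, so it cuts out an open and closed subset. *)
Lemma locally_constant_segment (R : realType) (P : R -> Prop) :
  (forall s : R, 0 <= s <= 1 -> \forall t \near s, P t <-> P s) -> P 0 ->
  forall s, 0 <= s <= 1 -> P s.
Proof.
move=> Ploc P0 u u01.
have ind (s : R) : 0 <= s <= 1 -> `[0, 1]%classic s by rewrite /= in_itv.
suff E : `[0, 1]%classic `&` P = `[0, 1]%classic.
  have : `[0, 1]%classic u by exact: ind.
  by rewrite -E => -[].
apply: segment_connected.
- by exists 0; split => //; apply: ind; rewrite lexx ler01.
- exists P°; first exact: open_interior.
  apply/seteqP; split => [s [s01 Ps]|s [s01 Ps]]; split => //.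
    have /Ploc : 0 <= s <= 1 by move: s01; rewrite /= in_itv.
    by apply: filterS => t [_ /(_ Ps)].
  exact: nbhs_singleton Ps.
- exists (~` (~` P)°); first by rewrite closedC; exact: open_interior.
  apply/seteqP; split => [s [s01 Ps]|s [s01 nPs]]; split => //.
    by move=> /nbhs_singleton.
  apply: contrapT => Ps; apply: nPs.
  have /Ploc : 0 <= s <= 1 by move: s01; rewrite /= in_itv.
  by apply: filterS => t [+ _] Pt => /(_ Pt).
Qed.

Lemma locally_constant_01 (R : realType) (P : R -> Prop) :
  (forall s : R, 0 <= s <= 1 -> \forall t \near s, P t <-> P s) -> P 0 -> P 1.
Proof.
by move=> Ploc P0; apply: (locally_constant_segment Ploc P0); rewrite lexx ler01.
Qed.

(** A division-free form of the equality of B / A and B' / A'. It yields the equivalence that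
    [locally_constant_01] asks for when the invariant is a proportion. *)
Lemma cross_mul (K : fieldType) (A B A' B' x y : K) : A != 0 -> A' != 0 ->
  A' * B = B' * A -> A' * y = B' * x <-> A * y = B * x.
Proof.
move=> A0 A'0 AB; split => e.
  apply: (mulfI A'0); transitivity (A * (A' * y)); first by ring.
  by rewrite e; transitivity (B' * A * x); [ring|rewrite -AB; ring].
apply: (mulfI A0); transitivity (A' * (A * y)); first by ring.
by rewrite e; transitivity (A' * B * x); [ring|rewrite AB; ring].
Qed.

(* The [S x] are local sections over the open sets [N x] of a bundle whose
   transition functions [S x / S x'] are locally constant: such a bundle has a
   global section over a disc. *)
Section Monodromy.
Variables (R : realType) (V : normedModType R) (K : fieldType) (M : R).
Variables (N : V -> set V) (S : V -> V -> K).
Hypothesis discM : compact [set x : V | `|x| <= M].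
Hypothesis N_open : forall x, open (N x).
Hypothesis N_refl : forall x, `|x| <= M -> N x x.
Hypothesis S_neq0 : forall x y, N x y -> S x y != 0.
Hypothesis S_compat : forall x x' y, N x y -> N x' y ->
  \forall z \near y, S x z * S x' y = S x' z * S x y.

Lemma segment_compat x x' y z :
  (forall s, 0 <= s <= 1 -> N x (y + s *: (z - y)) /\ N x' (y + s *: (z - y))) ->
  S x z * S x' y = S x' z * S x y.
Proof.
move=> seg; pose c (s : R) := y + s *: (z - y).
have c_cont : continuous c.
  by move=> s; apply: cvgD; [exact: cvg_cst|apply: cvgZr_tmp; exact: cvg_id].
have := @locally_constant_01 R (fun s => S x (c s) * S x' y = S x' (c s) * S x y).
have c1 : c 1 = z by rewrite /c scale1r addrC subrK.
have c0 : c 0 = y by rewrite /c scale0r addr0.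
rewrite /= c1 c0; apply; last by rewrite mulrC.
move=> s /seg[Nx Nx'].
have E1 := c_cont s _ (S_compat Nx Nx').
have E2 := c_cont s _ (open_nbhs_nbhs (conj (N_open x) Nx)).
near=> t.
have e1 : S x (c t) * S x' (c s) = S x' (c t) * S x (c s) by near: t.
have n1 : S x (c t) != 0 by apply: S_neq0; near: t.
have n2 := S_neq0 Nx.
exact: cross_mul e1.
Unshelve. all: by end_near.
Qed.

(** A Lebesgue number of the cover of the disc by the [N i], from the near-covering form of
    compactness. *)
Lemma compat_lebesgue : exists2 d : R, 0 < d &
  forall x, `|x| <= M -> exists2 i, `|i| <= M & forall y, `|y - x| < d -> N i y.
Proof.
have /compact_near_coveringP cov := discM.
have := cov R (0^'+) (fun d x =>
  exists2 i, `|i| <= M & forall y, `|y - x| < d -> N i y) _.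
case.
  move=> x xM.
  have /nbhs_ballP[e /= e0 eN] := open_nbhs_nbhs (conj (N_open x) (N_refl xM)).
  have e20 : 0 < e / 2 by rewrite divr_gt0.
  exists (ball x (e / 2), [set d | d < e / 2]) => /=.
    split; first exact: nbhsx_ballx.
    exact: nbhs_right_lt.
  move=> [x' d] /= [xx' de]; exists x => // y yx'; apply: eN.
  rewrite -ball_normE /= in xx' *.
  rewrite distrC -(subrKA x') (le_lt_trans (ler_normD _ _))// [ltRHS]splitr ltrD//.
    exact: lt_trans yx' de.
  by rewrite distrC.
move=> e /= e0 He; exists (e / 2); first by rewrite divr_gt0.
apply: He; rewrite /= ?divr_gt0//.
by rewrite sub0r normrN gtr0_norm ?divr_gt0// ltr_pdivrMr// ltr_pMr// ltr1n.
Qed.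

(** [T y] multiplies local transports along the radius from 0 to [y], cut into steps shorter than a
    third of a Lebesgue number. Moving [y] to [z] deforms the radius across a ladder of small cells,
    around each of which the transport is trivial because balls are convex. *)
Lemma monodromy : exists T : V -> K,
  (forall y, `|y| < M -> T y != 0) /\
  (forall y, `|y| < M -> \forall z \near y, T z * S y y = T y * S y z).
Proof.
have [d d0 dN] := compat_lebesgue.
have /choice[i iP] : forall x, exists i, `|x| <= M ->
    `|i| <= M /\ forall y, `|y - x| < d -> N i y.
  move=> x; have [/dN[i iM iN]|_] := boolP (`|x| <= M); last by exists 0.
  by exists i.
(* [l x y] transports from [x] to [y] along one section defined on the whole ball of radius [d]
   about [x]. The existential keeps it opaque. *)
have [l lE] : exists l : V -> V -> K, forall x y, l x y = S (i x) y / S (i x) x.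
  by eexists.
have self x : `|x| <= M -> N (i x) x.
  by move=> /iP[_]; apply; rewrite subrr normr0.
have l_neq0 x y : `|x| <= M -> `|y - x| < d -> l x y != 0.
  move=> xM yx; rewrite lE mulf_neq0 ?invr_eq0//; apply: S_neq0.
    by have [_ /(_ _ yx)] := iP _ xM.
  exact: self.
have ball_seg (x y z : V) (s : R) : 0 <= s <= 1 -> `|y - x| < d -> `|z - x| < d ->
    `|y + s *: (z - y) - x| < d.
  move=> /andP[s0 s1] yx zx.
  have -> : y + s *: (z - y) - x = (1 - s) *: (y - x) + s *: (z - x).
    rewrite scalerBl scale1r [RHS]addrAC -[RHS]addrA -scalerBr.
    by rewrite opprB addrA subrK addrAC.
  apply: (le_lt_trans (ler_normD _ _)); rewrite !normrZ.
  rewrite ger0_norm ?subr_ge0// ger0_norm//.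
  have [->|sn0] := eqVneq s 0; first by rewrite subr0 mul1r mul0r addr0.
  have -> : d = (1 - s) * d + s * d by rewrite -mulrDl subrK mul1r.
  apply: ler_ltD; first by apply: ler_wpM2l; [rewrite subr_ge0|exact: ltW].
  by rewrite ltr_pM2l// lt_neqAle eq_sym sn0.
have cocycle x y z : `|x| <= M -> `|y| <= M ->
    `|y - x| < d -> `|z - x| < d -> `|z - y| < d -> l x y * l y z = l x z.
  move=> xM yM yx zx zy.
  have Sy := S_neq0 (self _ yM).
  have e : S (i x) z * S (i y) y = S (i y) z * S (i x) y.
    apply: segment_compat => s s01.
    split; [have [_] := iP _ xM|have [_] := iP _ yM]; apply; apply: ball_seg => //.
    by rewrite subrr normr0.
  by rewrite !lE mulf_div [X in X / _]mulrC -e -mulf_div divff// mulr1.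
(* Sides and diagonals of the ladder cells must be shorter than [d]; two sides below d / 3 leave
   room for this. *)
have [n nP] : exists n : nat, M / n.+1%:R < d / 3.
  exists (Num.truncn (M / (d / 3))).
  rewrite ltr_pdivrMr// mulrC -ltr_pdivrMr ?divr_gt0//.
  exact: truncnS_gt.
pose p (k : nat) (y : V) := (k%:R / n.+1%:R : R) *: y.
have p0 y : p 0 y = 0 by rewrite /p mul0r scale0r.
have pn y : p n.+1 y = y by rewrite /p divff ?pnatr_eq0// scale1r.
have pM k (y : V) : (k <= n.+1)%N -> `|y| <= M -> `|p k y| <= M.
  move=> kn yM; rewrite normrZ ger0_norm ?divr_ge0//.
  apply: le_trans yM; rewrite ler_piMl// ler_pdivrMr// mul1r ler_nat//.
have pS k (y : V) : `|y| <= M -> `|p k.+1 y - p k y| < d / 3.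
  move=> yM; rewrite /p -scalerBl -mulrBl -natrB// subSnn normrZ.
  rewrite ger0_norm ?divr_ge0//; apply: le_lt_trans nP.
  by rewrite mulrAC mul1r ler_pM2r ?invr_gt0.
have pD k (y z : V) : (k <= n.+1)%N -> `|p k z - p k y| <= `|z - y|.
  move=> kn; rewrite /p -scalerBr normrZ ger0_norm ?divr_ge0//.
  by rewrite ler_piMl// ler_pdivrMr// mul1r ler_nat.
have d3 : d / 3 < d by rewrite ltr_pdivrMr// ltr_pMr// ltr1n.
have dd3 : d / 3 + d / 3 < d by lra.
exists (fun y => \prod_(k < n.+1) l (p k y) (p k.+1 y)); split.
  move=> y /ltW yM; apply/prodf_neq0 => k _; apply: l_neq0.
    by apply: pM => //; exact: ltnW.
  exact: lt_trans (pS _ _ yM) _.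
move=> y yM.
have yM' := ltW yM.
have Nyz : \forall z \near y, S y z * S (i y) y = S (i y) z * S y y.
  by apply: S_compat; [exact: N_refl|exact: self].
have nz : \forall z \near y, `|z| < M.
  have : (fun z : V => `|z|) @ y --> `|y| by apply: cvg_norm; exact: cvg_id.
  by move=> /(_ _ (open_nbhs_nbhs (conj (@open_lt R M) yM))).
have nd : \forall z \near y, `|z - y| < d / 3.
  by have := @nbhsx_ballx _ _ y (d / 3) ltac:(by rewrite divr_gt0);
    rewrite -ball_normE; apply: filterS => z /=; rewrite distrC.
near=> z.
have zM : `|z| <= M by apply: ltW; near: z.
have zy : `|z - y| < d / 3 by near: z.
(* Going [k] steps along the radius of [y] and then across a rung equals going [k] steps along the
   radius of [z]. *)
have main k : (k <= n.+1)%N ->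
   (\prod_(j < k) l (p j y) (p j.+1 y)) * l (p k y) (p k z) =
    \prod_(j < k) l (p j z) (p j.+1 z).
  elim: k => [_|k IH kn].
    rewrite !big_ord0 mul1r !p0 lE divff//; apply: S_neq0; apply: self.
    by rewrite normr0 (le_trans _ yM').
  have kn' := ltnW kn.
  rewrite !big_ord_recr /= -IH//.
  have e1 : `|p k.+1 y - p k y| < d / 3 by exact: pS.
  have e2 : `|p k.+1 z - p k.+1 y| < d / 3 by exact: le_lt_trans (pD _ _ _ _) zy.
  have e3 : `|p k z - p k y| < d / 3 by exact: le_lt_trans (pD _ _ _ _) zy.
  have e4 : `|p k.+1 z - p k z| < d / 3 by exact: pS.
  have e5 : `|p k.+1 z - p k y| < d.
    rewrite -(subrKA (p k z)) (le_lt_trans (ler_normD _ _))// (lt_trans _ dd3)//.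
    exact: ltrD.
  rewrite -!mulrA; congr (_ * _).
  (* Both ways around the cell equal the transport along its diagonal from [p k y] to [p k.+1 z]. *)
  rewrite cocycle ?cocycle ?pM//; exact: lt_trans d3.
have := main _ (leqnn _); rewrite !pn => <-.
have e : S y z * S (i y) y = S (i y) z * S y y by near: z.
rewrite -mulrA; congr (_ * _).
by rewrite lE mulrAC -e mulfK//; apply: S_neq0; apply: self.
Unshelve. all: by end_near.
Qed.

End Monodromy.

(** * Continuity at a point and signs of square roots *)

Section Continuity.
Variables (K : numFieldType) (T : topologicalType).

Lemma continuous_atM (f g : T -> K) x : {for x, continuous f} ->
  {for x, continuous g} -> {for x, continuous (fun t => f t * g t)}.
Proof. exact: cvgM. Qed.

Lemma continuous_atV (f : T -> K) x : f x != 0 -> {for x, continuous f} ->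
  {for x, continuous (fun t => (f t)^-1)}.
Proof. exact: cvgV. Qed.

Lemma continuous_atZ (V : normedModType K) (f : T -> K) (g : T -> V) x :
  {for x, continuous f} ->
  {for x, continuous g} -> {for x, continuous (fun t => f t *: g t)}.
Proof. exact: cvgZ. Qed.

Lemma continuous_atD (V : normedModType K) (f g : T -> V) x :
  {for x, continuous f} ->
  {for x, continuous g} -> {for x, continuous (fun t => f t + g t)}.
Proof. exact: cvgD. Qed.

Lemma continuous_at_cst (U : topologicalType) (c : U) x :
  {for x, continuous (fun _ : T => c)}.
Proof. exact: cvg_cst. Qed.

Lemma near_eq_continuous_at (U : topologicalType) (f g : T -> U) x :
  (\forall t \near x, f t = g t) -> {for x, continuous f} -> {for x, continuous g}.
Proof.
move=> fg fc; have gfx : g x = f x by rewrite (nbhs_singleton fg).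
change (g @ x --> g x); rewrite gfx; apply: cvg_trans fc.
by apply: near_eq_cvg; exact: fg.
Qed.

(** At [y] the factor [A + B] of the difference of squares is twice [A y], so it stays nonzero
    nearby and the other factor vanishes. *)
Lemma near_eq_of_sqr (A B : T -> K) y :
  {for y, continuous A} -> {for y, continuous B} -> A y = B y -> A y != 0 ->
  (\forall z \near y, A z ^+ 2 = B z ^+ 2) -> \forall z \near y, A z = B z.
Proof.
move=> cA cB AB A0 sqr.
have cAB : (fun z => A z + B z) @ y --> A y + B y by exact: cvgD.
have nz : \forall z \near y, A z + B z != 0.
  by apply: cvgr_neq0 cAB _; rewrite -AB -mulr2n mulrn_eq0.
apply: filterS2 nz sqr => z /negbTE nz /eqP.
by rewrite eqf_sqr -[_ == - _]addr_eq0 nz orbF => /eqP.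
Qed.

End Continuity.

(** Agreement of [A] and [B] is an open condition by [near_eq_of_sqr], disagreement by
    continuity. *)
Lemma sqrt_unique (R : realType) (K : numFieldType) (A B : R -> K) :
  (forall s, 0 <= s <= 1 -> [/\ {for s, continuous A}, {for s, continuous B},
     A s != 0 & \forall t \near s, A t ^+ 2 = B t ^+ 2]) ->
  A 0 = B 0 -> A 1 = B 1.
Proof.
move=> AB; apply: (@locally_constant_01 _ (fun s => A s = B s)) => s /AB[cA cB A0 sqr].
have [eq|/eqP ne] := pselect (A s = B s).
  by apply: filterS (near_eq_of_sqr cA cB eq A0 sqr) => t ->.
have cAB : (fun t => A t - B t) @ s --> A s - B s by exact: cvgB.
have : \forall t \near s, A t - B t != 0 by apply: cvgr_neq0 cAB _; rewrite subr_eq0.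
apply: filterS => t; rewrite subr_eq0 => /eqP net.
by split => // /eqP; rewrite (negbTE ne).
Qed.

(** * Square roots in the complex plane *)

Section ComplexPlane.
Variable R : realType.
Local Notation C := R[i].
Local Notation E := (R * R)%type.

(* C is identified with R * R and the sup norm, which takes values in R, whereas
   the norm of [R[i]] takes values in [R[i]]. *)
Definition plane (p : E) : C := Complex p.1 p.2.
Definition coords (z : C) : E := (complex.Re z, complex.Im z).

Lemma coordsK : cancel coords plane. Proof. by case. Qed.
Lemma planeK : cancel plane coords. Proof. by case. Qed.

Lemma gt0_complex (e : C) : 0 < e -> exists2 r : R, 0 < r & e = r%:C%C.
Proof.
by case: e => a b; rewrite ltcE /= => /andP[/eqP -> a0]; exists a.
Qed.

Lemma normc_i : `|'i%C : C| = 1.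
Proof. by rewrite normc_def /= expr0n add0r expr1n sqrtr1. Qed.

Lemma normc_le_ReIm (z : C) :
  `|z| <= (`|complex.Re z| + `|complex.Im z|)%:C%C.
Proof.
rewrite [X in `|X|]complexE (le_trans (ler_normD _ _))// rmorphD /=.
rewrite normrM normc_i mul1r lerD// normc_def/= expr0n addr0 sqrtr_sqr//.
Qed.

Lemma plane_continuous : continuous plane.
Proof.
move=> p; apply/cvgrPdist_lt => e /gt0_complex[r r0 ->].
have r2 : 0 < r / 2 by rewrite divr_gt0.
have : \forall q \near p, `|p - q| < r / 2.
  by have /cvgrPdist_lt/(_ _ r2) := @cvg_id _ (nbhs p).
apply: filterS => q; rewrite prod_normE gt_max => /andP[q1 q2].
apply: (le_lt_trans (normc_le_ReIm _)).
by rewrite ltcR [ltRHS]splitr; apply: ltrD.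
Qed.

Lemma Re_continuous : continuous (@complex.Re R).
Proof.
move=> z; apply/(@cvgrPdist_lt _ _ _ _ (nbhs_filter z)) => e e0.
have e0C : 0 < e%:C%C by rewrite ltcR.
have /cvgrPdist_lt/(_ _ e0C) : x @[x --> (z : C)] --> (z : C) by exact: cvg_id.
apply: filterS => w zw; rewrite -ltcR (le_lt_trans _ zw)//.
by apply: le_trans (normc_ge_Re (z - w)); rewrite raddfB.
Qed.

Lemma near_Re_gt0 (w : C) : 0 < complex.Re w ->
  \forall z \near w, 0 < complex.Re z.
Proof.
move=> w0; apply: (@Re_continuous w [set r | 0 < r]).
by apply: open_nbhs_nbhs; split => //; exact: open_gt.
Qed.

Lemma Im_continuous : continuous (@complex.Im R).
Proof.
move=> z; apply/(@cvgrPdist_lt _ _ _ _ (nbhs_filter z)) => e e0.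
have e0C : 0 < e%:C%C by rewrite ltcR.
have /cvgrPdist_lt/(_ _ e0C) : x @[x --> (z : C)] --> (z : C) by exact: cvg_id.
apply: filterS => w zw; rewrite -ltcR (le_lt_trans _ zw)//.
have -> : complex.Im z - complex.Im w = complex.Re ((z - w) * - 'i%C).
  by rewrite mulrN raddfN /= ReiNIm opprK raddfB.
by apply: le_trans (normc_ge_Re _) _; rewrite normrM normrN normc_i mulr1.
Qed.

Lemma coords_continuous : continuous coords.
Proof. by move=> z; apply: (cvg_pair (@Re_continuous z) (@Im_continuous z)). Qed.

Lemma compact_plane_disc (M : R) : compact [set p : E | `|p| <= M].
Proof.
have -> : [set p : E | `|p| <= M] = `[- M, M]%classic `*` `[- M, M]%classic.
  by apply/seteqP; split => -[x y] /=;
    rewrite !in_itv /= prod_normE /= ge_max !ler_norml => /andP.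
by apply: compact_setX; exact: segment_compact.
Qed.

Lemma plane_eq0 (p : E) : (plane p == 0) = (p == 0).
Proof.
apply/eqP/eqP => [p0|->]; last by [].
by rewrite -(planeK p) p0.
Qed.

(* The branch of the square root with positive real part; only meaningful
   when [0 < complex.Re w]. *)
Definition psqrt (w : C) : C :=
  if 0 < complex.Re (sqrtc w) then sqrtc w else - sqrtc w.

Lemma sqr_psqrt w : psqrt w ^+ 2 = w.
Proof. by rewrite /psqrt; case: ifP => _; rewrite ?sqrrN sqr_sqrtc. Qed.

Lemma psqrt_gt0 w : 0 < complex.Re w -> 0 < complex.Re (psqrt w).
Proof.
rewrite -{1}(sqr_sqrtc w) /psqrt; case: ifP => // /negbT.
case: (sqrtc w) => a b /=; rewrite -leNgt => a0 ab.
rewrite oppr_gt0 lt_neqAle a0 andbT; apply: contraTneq ab => ->.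
by rewrite mulr0 sub0r oppr_gt0 -leNgt -expr2 sqr_ge0.
Qed.

Lemma psqrt_uniq (s t : C) :
  0 < complex.Re s -> 0 < complex.Re t -> s ^+ 2 = t ^+ 2 -> s = t.
Proof.
move=> s0 t0 /eqP; rewrite eqf_sqr => /orP[/eqP //|/eqP st].
move: s0; rewrite st; case: t t0 {st} => a b /=.
by rewrite oppr_gt0 => /ltW; rewrite leNgt => /negbTE ->.
Qed.

(** The difference w - z is the product of the difference and the sum of the roots, and the real
    part of the sum is at least that of [psqrt w]. *)
Lemma psqrt_continuous w : 0 < complex.Re w -> {for w, continuous psqrt}.
Proof.
move=> w0; apply/(@cvgrPdist_lt _ _ _ _ (nbhs_filter w)) => e /gt0_complex[r r0 ->].
have s0 := psqrt_gt0 w0.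
have e0C : 0 < (r * complex.Re (psqrt w))%:C%C by rewrite ltcR mulr_gt0.
near=> z.
have z0 : 0 < complex.Re z.
  by near: z; exact: near_Re_gt0.
have zw : `|w - z| < (r * complex.Re (psqrt w))%:C%C.
  near: z.
  by have /cvgrPdist_lt/(_ _ e0C) : x @[x --> (w : C)] --> (w : C) by exact: cvg_id.
have t0 := psqrt_gt0 z0.
have le1 : (complex.Re (psqrt w))%:C%C <= `|psqrt w + psqrt z|.
  apply: le_trans (normc_ge_Re _); rewrite lecR (le_trans _ (ler_norm _))//.
  by move: t0; case: (psqrt w) (psqrt z) => a b [c d] /= /ltW; rewrite lerDl.
have sC : 0 < (complex.Re (psqrt w))%:C%C by rewrite ltcR.
rewrite -(ltr_pM2r sC); apply: (le_lt_trans (y := `|w - z|)).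
  have -> : w - z = psqrt w ^+ 2 - psqrt z ^+ 2 by rewrite !sqr_psqrt.
  rewrite subr_sqr normrM.
  by rewrite ler_wpM2l.
by rewrite -rmorphM.
Unshelve. all: by end_near.
Qed.

(** The local branches [psqrt (f y / f x)] have quotients with constant square, hence locally
    constant, and [monodromy] glues them. The margin between [M] and [M'] puts the compact disc
    inside the open disc where [f] is continuous and nonzero. *)
Lemma continuous_sqrt (f : E -> C) (M M' : R) : 0 < M -> M < M' -> f 0 = 1 ->
  (forall x, `|x| < M' -> {for x, continuous f} /\ f x != 0) ->
  exists m : E -> C, m 0 = 1 /\
    forall x, `|x| < M -> {for x, continuous m} /\ m x ^+ 2 = f x.
Proof.
move=> M0 MM' f0 fM.
pose N (x : E) : set E :=
  [set y | `|x| < M' /\ `|y| < M'] `&` [set y | 0 < complex.Re (f y / f x)]°.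
have c1 : 0 < complex.Re (1 : C) by exact: ltr01.
have ratio x y : `|x| < M' -> `|y| < M' ->
    {for y, continuous (fun z => f z / f x)}.
  by move=> xM yM; apply: continuous_atM; [exact: (fM y yM).1|exact: continuous_at_cst].
have NE x y : N x y -> [/\ `|x| < M', `|y| < M' & 0 < complex.Re (f y / f x)].
  by move=> [[xM yM] /nbhs_singleton].
have cS x y : N x y -> {for y, continuous (fun z => psqrt (f z / f x))}.
  move=> /NE[xM yM re0]; apply: (@continuous_comp _ _ _ (fun z => f z / f x) psqrt).
    exact: ratio.
  exact: psqrt_continuous.
have [|x|x xM|x y|x x' y Nx Nx'|T [T0 Tloc]] :=
    @monodromy R E C M N (fun x y => psqrt (f y / f x)).
- exact: compact_plane_disc.
- apply: openI; last exact: open_interior.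
  have [xM|xM] := boolP (`|x| < M').
    rewrite (_ : [set _ | _] = [set y : E | `|y| < M']); last first.
      by apply/seteqP; split => [y []|y].
    by apply: (@open_comp _ _ (fun y : E => `|y|) [set r | r < M']);
      [move=> ? _; exact: norm_continuous|exact: open_lt].
  rewrite (_ : [set _ | _] = set0); first exact: open0.
  by apply/seteqP; split => [y []|y]//; rewrite (negbTE xM).
- have xM' := le_lt_trans xM MM'; split => //.
  apply: (ratio _ _ xM' xM' [set w | 0 < complex.Re w]).
  apply: (@Re_continuous _ [set r | 0 < r]).
  by apply: open_nbhs_nbhs; split; [exact: open_gt|rewrite /= divff//; case: (fM x xM')].
- move=> /NE[xM yM re0]; rewrite -sqrf_eq0 sqr_psqrt.
  by rewrite mulf_neq0 ?invr_eq0//; [case: (fM y yM)|case: (fM x xM)].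
- have [xM yM re0] := NE _ _ Nx; have [xM' _ re0'] := NE _ _ Nx'.
  apply: near_eq_of_sqr.
  + by apply: continuous_atM; [exact: cS|exact: continuous_at_cst].
  + by apply: continuous_atM; [exact: cS|exact: continuous_at_cst].
  + exact: mulrC.
  + rewrite -sqrf_eq0 exprMn !sqr_psqrt.
    have [fx fy fx'] := And3 (fM x xM).2 (fM y yM).2 (fM x' xM').2.
    by rewrite !mulf_neq0 ?invr_eq0.
  + apply: (@filterE _ _ (nbhs_filter (y : E))) => z.
    by rewrite !exprMn !sqr_psqrt !mulf_div (mulrC (f x)).
have fy0 y : `|y| < M -> f y != 0.
  by move=> yM; have [] := fM _ (lt_trans yM MM').
have psq1 : psqrt 1 = 1 by apply: psqrt_uniq; rewrite ?sqr_psqrt ?expr1n// psqrt_gt0.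
have Tz y : `|y| < M -> \forall z \near y, T z = T y * psqrt (f z / f y).
  move=> yM; apply: filterS (Tloc y yM) => z.
  by rewrite divff ?fy0// psq1 mulr1.
have z0 : `|0 : E| < M by rewrite normr0.
have Nyy y : `|y| < M -> {for y, continuous (fun z => psqrt (f z / f y))}.
  move=> yM; have yM' := lt_trans yM MM'.
  apply: (@continuous_comp _ _ _ (fun z => f z / f y) psqrt); first exact: ratio.
  by apply: psqrt_continuous; rewrite divff ?fy0.
exists (fun x => T x / T 0); split; first by rewrite divff// T0.
move=> x xM; split.
  apply: continuous_atM; last exact: continuous_at_cst.
  apply: (@near_eq_continuous_at _ _ (fun z => T x * psqrt (f z / f x))).
    by apply: filterS (Tz x xM) => z ->.
  by apply: continuous_atM; [exact: continuous_at_cst|exact: Nyy].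
(* The quotient of [T ^+ 2] by [f] is locally constant along the radius to [x], and it is [T 0 ^+ 2]
   at 0. *)
have := @locally_constant_01 R (fun s => T (s *: x) ^+ 2 = T 0 ^+ 2 * f (s *: x)).
rewrite /= scale1r scale0r f0 mulr1 => H.
rewrite exprMn exprVn H ?(mulrC (T 0 ^+ 2)) ?mulfK// ?sqrf_eq0 ?T0//.
move=> s /andP[s0 s1].
have sxM : `|s *: x| < M.
  by rewrite normrZ ger0_norm// (le_lt_trans _ xM)// ler_piMl.
have cc : (fun t : R => t *: x) @ s --> s *: x by apply: cvgZr_tmp; exact: cvg_id.
have n1 : \forall t \near s, T (t *: x) = T (s *: x) * psqrt (f (t *: x) / f (s *: x)).
  exact: (cc _ (Tz _ sxM)).
have n2 : \forall t \near s, `|t *: x| < M.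
  apply: (cc [set y | `|y| < M]); apply: open_nbhs_nbhs; split => //.
  by apply: (@open_comp _ _ (fun y : E => `|y|) [set r | r < M]);
    [move=> ? _; exact: norm_continuous|exact: open_lt].
apply: filterS2 n1 n2 => t /= tE /fy0 ft0.
have fs0 := fy0 _ sxM.
rewrite tE exprMn sqr_psqrt; split => e.
  by apply: (mulIf ft0); rewrite [RHS]mulrAC -e -[RHS]mulrA divfK.
by rewrite e -[LHS]mulrA; congr (_ * _); rewrite mulrC divfK.
Qed.

End ComplexPlane.

(** * Lifting along a local homeomorphism *)

Section Lifting.
Variables (R : realType) (X Y : topologicalType) (F : X -> Y).
Hypothesis X_hausdorff : hausdorff_space X.
Hypothesis F_open : forall x O, nbhs x O -> nbhs (F x) (F @` O).
Hypothesis F_inj : forall x, exists2 U, open_nbhs x U &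
  forall y z, U y -> U z -> F y = F z -> y = z.

Lemma near_lift_eq (T : topologicalType) (f g : T -> X) t :
  {for t, continuous f} -> {for t, continuous g} ->
  (\forall s \near t, F (f s) = F (g s)) -> f t = g t ->
  \forall s \near t, f s = g s.
Proof.
move=> fc gc Ffg fg; have [U Uft Uinj] := F_inj (f t).
have nU := open_nbhs_nbhs Uft.
have n1 : \forall s \near t, U (f s) by exact: fc.
have n2 : \forall s \near t, U (g s) by apply: gc; rewrite -fg.
by apply: filterS3 Ffg n1 n2 => s e u1 u2; exact: Uinj.
Qed.

Lemma near_neq (T : topologicalType) (f g : T -> X) t :
  {for t, continuous f} -> {for t, continuous g} -> f t != g t ->
  \forall s \near t, f s != g s.
Proof.
move=> fc gc ne; move: X_hausdorff; rewrite open_hausdorff => /(_ _ _ ne).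
move=> [[A B] /= [fA gB] [oA oB /eqP AB]].
have n1 : \forall s \near t, A (f s).
  by apply: fc; apply: open_nbhs_nbhs; split => //; rewrite inE in fA.
have n2 : \forall s \near t, B (g s).
  by apply: gc; apply: open_nbhs_nbhs; split => //; rewrite inE in gB.
apply: filterS2 n1 n2 => s As Bs; apply/eqP => e;
  suff : (A `&` B) (f s) by rewrite AB.
by split => //; rewrite e.
Qed.

(** Agreement of two lifts is open since [F] is locally injective, disagreement is open since [X] is
    Hausdorff. *)
Lemma lift_unique (f g : R -> X) :
  (forall s, 0 <= s <= 1 -> [/\ {for s, continuous f}, {for s, continuous g} &
     \forall t \near s, F (f t) = F (g t)]) ->
  f 0 = g 0 -> forall s, 0 <= s <= 1 -> f s = g s.
Proof.
move=> fg; apply: (@locally_constant_segment _ (fun s => f s = g s)) => s /fg[fc gc e].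
have [eq|/eqP ne] := pselect (f s = g s).
  by apply: filterS (near_lift_eq fc gc e eq) => t ->.
by apply: filterS (near_neq fc gc ne) => t /eqP ?; split => // /eqP; rewrite (negbTE ne).
Qed.

Section Tube.
Variables (V : normedModType R) (P : topologicalType) (M : R).
Variables (f : V -> X) (phi : V -> P -> Y) (p0 : P).
Hypothesis discM : compact [set x : V | `|x| <= M].
Hypothesis f_cont : continuous f.
Hypothesis phi_cont : continuous (fun xp : V * P => phi xp.1 xp.2).
Hypothesis phi_p0 : forall x, phi x p0 = F (f x).

(* A neighborhood of the graph of [f] on whose slices [F] is injective. *)
Lemma tube_nbhd : exists W : V -> set X, [/\
  forall x y, W x y -> \forall x' \near x & y' \near y, W x' y',
  forall x, W x (f x) &
  forall x y z, `|x| <= M -> W x y -> W x z -> F y = F z -> y = z].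
Proof.
have /choice[U UP] : forall x, exists U, open_nbhs (f x) U /\
    forall y z, U y -> U z -> F y = F z -> y = z.
  by move=> x; have [U ? ?] := F_inj (f x); exists U.
have /choice[r rP] : forall x, exists r : R, 0 < r /\
    forall y, `|y - x| <= r -> U x (f y).
  move=> x; have [Ux _] := UP x.
  have /nbhs_ballP[e /= e0 eU] := f_cont (open_nbhs_nbhs Ux).
  exists (e / 2); split; first by rewrite divr_gt0.
  move=> y yx; apply: eU; rewrite -ball_normE /= distrC (le_lt_trans yx)//.
  by rewrite ltr_pdivrMr// ltr_pMr// ltr1n.
have := discM; rewrite compact_cover.
move=> /(_ V setT (fun x => ball x (r x)))[].
- by move=> x _; apply: ball_open; exact: (rP x).1.
- by move=> x _; exists x => //; apply: ballxx; exact: (rP x).1.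
move=> D _ Dcov.
(* [W x] is the intersection of the [U i] over the finitely many closed balls that contain [x]. As
   the balls are closed, no new condition arises near [x], so [W] is open. *)
exists (fun x y => forall i, i \in D -> `|x - i| <= r i -> U i y); split.
- move=> x y Wxy.
  have := @filter_bigI _ _ D (fun i => [set z : V * X | `|z.1 - i| <= r i -> U i z.2])
    (nbhs (x, y)) (nbhs_filter (x, y)).
  move=> /(_ _)[|[A B] [/= nA nB] ABW].
    move=> i iD; have [le|] := boolP (`|x - i| <= r i).
      have nU : nbhs y (U i).
        by apply: open_nbhs_nbhs; split; [exact: (UP i).1.1|exact: Wxy].
      by exists (setT, U i); [split => //=; exact: filterT|move=> z [_ Uz] _].
    rewrite -ltNge => lt.
    have c : (fun z : V => `|z - i|) @ x --> `|x - i|.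
      by apply: cvg_norm; apply: cvgB; [exact: cvg_id|exact: cvg_cst].
    have nlt : nbhs x [set z | r i < `|z - i|].
      by apply: (c [set t | r i < t]); apply: open_nbhs_nbhs; split => //; exact: open_gt.
    exists ([set z | r i < `|z - i|], setT); first by split => //=; exact: filterT.
    by move=> z [/= zi _]; rewrite leNgt zi.
  exists (A, B) => // z zAB i iD; exact: (ABW z zAB i iD).
- by move=> x i _ /(rP i).2.
- move=> x y z xM Wy Wz Fyz.
  have [i iD xi] := Dcov x xM.
  have le : `|x - i| <= r i by move: xi; rewrite -ball_normE /= distrC => /ltW.
  by apply: (UP i).2 Fyz; [exact: Wy|exact: Wz].
Qed.

(** [G p x] is the only point of [W x] over [phi x p]. It exists for [p] near [p0] because [F] is
    open, uniformly on the compact disc, and its uniqueness in [W x] forces continuity. *)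
Lemma tube : exists G : P -> V -> X,
  (forall x O, `|x| < M -> nbhs (f x) O ->
     \forall x' \near x & p \near p0, O (G p x')) /\
  \forall p \near p0, forall x, `|x| < M ->
     {for x, continuous (G p)} /\ F (G p x) = phi x p.
Proof.
have [W [Wopen Wf Winj]] := tube_nbhd.
(* A point of [W x] over [phi x p] persists, close to itself, when [x] and [p] move. *)
have step x p y O : W x y -> F y = phi x p -> nbhs y O ->
    \forall x' \near x & p' \near p, exists y', [/\ O y', W x' y' & F y' = phi x' p'].
  move=> Wxy Fy Oy; have [[A B] /= [nA nB] AB] := Wopen _ _ Wxy.
  have nFB : nbhs (phi x p) (F @` (O `&` B)).
    by rewrite -Fy; apply: F_open; exact: filterI.
  have [[A' P'] /= [nA' nP'] AP] := @phi_cont (x, p) _ nFB.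
  exists (A `&` A', P'); first by split => //=; exact: filterI.
  move=> [x' p'] /= [[Ax' A'x'] P'p'].
  have [y' [Oy' By'] Fy'] := AP (x', p') (conj A'x' P'p').
  by exists y'; split => //; exact: (AB (x', y')).
pose G p x := xget (f 0) [set y | W x y /\ F y = phi x p].
have GE p x y : `|x| <= M -> W x y -> F y = phi x p -> G p x = y.
  move=> xM Wxy Fy; rewrite /G; case: xgetP => [z _ [Wz Fz]|/(_ y)[]//].
  by apply: (Winj x) => //; rewrite Fz.
have near_disc (x : V) : `|x| < M -> \forall x' \near x, `|x'| <= M.
  move=> xM; have : nbhs x [set z | `|z| < M].
    apply: (@norm_continuous _ _ x [set r | r < M]).
    by apply: open_nbhs_nbhs; split => //; exact: open_lt.
  by apply: filterS => z /ltW.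
have ex : \forall p \near p0, [set x : V | `|x| <= M] `<=`
    (fun x => exists y, W x y /\ F y = phi x p).
  have /compact_near_coveringP cov := discM.
  apply: (cov _ (nbhs p0) (fun p x => exists y, W x y /\ F y = phi x p)) => x _.
  have [[A B] nAB AB] := step x p0 (f x) setT (Wf x) (esym (phi_p0 x)) filterT.
  by exists (A, B) => // z /AB[y' [_ ? ?]]; exists y'.
exists G; split.
  move=> x O xM nO.
  have [[A B] /= [nA nB] AB] := step x p0 (f x) O (Wf x) (esym (phi_p0 x)) nO.
  exists (A `&` [set x' | `|x'| <= M], B).
    by split => //=; apply: filterI => //; exact: near_disc.
  move=> [x' p'] /= [[Ax' x'M] Bp'].
  have [y' [Oy' Wy' Fy']] := AB (x', p') (conj Ax' Bp').
  by rewrite (GE _ _ y').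
apply: filterS ex => p exp x xM.
have [y [Wy Fy]] := exp x (ltW xM).
have Gx : G p x = y by apply: GE => //; exact: ltW.
split; last by rewrite Gx.
move=> O; rewrite Gx => nO.
have [[A B] /= [nA nB] AB] := step x p y O Wy Fy nO.
have nM := near_disc x xM.
apply: filterS2 nA nM => x' Ax' x'M.
have [y' [Oy' Wy' Fy']] := AB (x', p) (conj Ax' (nbhs_singleton nB)).
by rewrite /= (GE _ _ y').
Qed.

End Tube.
End Lifting.

(** * Transport between fibers *)

Section Transport.
Variable R : realType.
Local Notation C := R[i].
Local Notation E := (R * R)%type.
Variables (X : topologicalType) (Y : normedModType C) (F : X -> Y).

(* [e] parametrizes the fiber over the line through [F a] with direction [v], and
   [c] is the inverse of [e] on this fiber. In the parameter [t] the map [F] reads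
   [F a + (t * k t) *: v], and [k 0 = 1] normalizes its derivative at [a]. *)
Definition fiber_coordinate (a : X) (v : Y) (e : C -> X) (c : X -> C)
    (k : C -> C) :=
  [/\ e 0 = a, continuous e, forall t, F (e t) = F a + (t * k t) *: v,
      cancel e c & forall x y, F x = F a + y *: v -> e (c x) = x] /\
  [/\ forall x y O, F x = F a + y *: v -> nbhs (c x) O ->
        \forall x' \near x, (exists y', F x' = F a + y' *: v) -> O (c x'),
      continuous (fun t : C => t * k t), {for (0 : C), continuous k} & k 0 = 1].

Hypothesis X_hausdorff : hausdorff_space X.
Hypothesis F_open : forall x O, nbhs x O -> nbhs (F x) (F @` O).
Hypothesis F_inj : forall x, exists2 U, open_nbhs x U &
  forall y z, U y -> U z -> F y = F z -> y = z.
Variables (a b : X) (v : E -> Y).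
Hypothesis ab : a != b.
Hypothesis Fab : F a = F b.
Hypothesis v_cont : continuous v.
Hypothesis v_neq0 : forall p, v p != 0.
Variables (e : E -> C -> X) (c : E -> X -> C) (k : E -> C -> C).
Hypothesis coordE : forall p, fiber_coordinate a (v p) (e p) (c p) (k p).

Let h p t := t * k p t.
Let tau p := c p b.
Let x_ p : E := coords (tau p).

Lemma coord_Fe p t : F (e p t) = F a + h p t *: v p.
Proof. by case: (coordE p) => -[]. Qed.

Lemma coord_ca p : c p a = 0.
Proof. by case: (coordE p) => -[ea _ _ eK _] _; rewrite -ea eK. Qed.

Lemma coord_eb p : e p (tau p) = b.
Proof.
by case: (coordE p) => -[_ _ _ _ cK] _; apply: (cK _ 0); rewrite scale0r addr0.
Qed.

Lemma coord_c_eq0 p x y : F x = F a + y *: v p -> c p x = 0 -> x = a.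
Proof. by case: (coordE p) => -[<- _ _ _ cK] _ /cK + c0; rewrite c0. Qed.

Lemma tau_neq0 p : tau p != 0.
Proof.
apply: contra_neq ab => t0.
by rewrite -(coord_eb p) t0; case: (coordE p) => -[].
Qed.

Lemma coord_h p x y : F x = F a + y *: v p -> h p (c p x) = y.
Proof.
move=> Fx; case: (coordE p) => -[_ _ _ _ cK] _.
have := coord_Fe p (c p x); rewrite (cK _ _ Fx) Fx => /addrI/eqP.
rewrite -subr_eq0 -scalerBl scaler_eq0 (negbTE (v_neq0 p)) orbF subr_eq0.
by move=> /eqP.
Qed.

Lemma coord_c_cvg p (T : Type) (Phi : set_system T) (FPhi : Filter Phi)
    (g : T -> X) x y : F x = F a + y *: v p ->
  g @ Phi --> x -> (\forall t \near Phi, exists y, F (g t) = F a + y *: v p) ->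
  (fun t => c p (g t)) @ Phi --> c p x.
Proof.
move=> Fx gx gF O nO; have [_ [/(_ _ _ _ Fx nO) nc _ _ _]] := coordE p.
have := gx _ nc; rewrite /= => n1.
by apply: filterS2 gF n1 => t Ft; apply.
Qed.

(* [G] moves the disc of radius [K] of the fiber over [v p0], which is identified
   with C by [e p0], to the fiber over [v p]. *)
Definition transport p0 p (K : R) (G : E -> X) :=
  [/\ G 0 = a, G (x_ p0) = b, forall x : E, `|x| < K -> x != 0 -> G x != a &
    forall x : E, `|x| < K -> {for x, continuous G} /\
      F (G x) = F a + h p0 (plane x) *: v p].

Lemma transport_le p0 p K K' G : K' <= K -> transport p0 p K G ->
  transport p0 p K' G.
Proof.
move=> KK' [G0 Gb Ga GF]; split => // x xK'; [apply: Ga|apply: GF];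
  exact: lt_le_trans KK'.
Qed.

Lemma norm_open (x : E) K : `|x| < K -> \forall y \near x, `|y| < K.
Proof.
move=> xK; apply: (@norm_continuous _ _ x [set r | r < K]).
by apply: open_nbhs_nbhs; split => //; exact: open_lt.
Qed.

(** [tube] moves [e p0] to lifts with the same parameter [h p0] on the line of direction [v p].
    Where this parameter is 0, as at [a] and [b], the image [F a] does not move, so neither does the
    lift. A lift can meet [a] only at 0: near 0 since [k p0] is not 0 there, elsewhere by closeness
    to [e p0]. *)
Lemma transport_exists p0 K : `|x_ p0| < K -> exists G : E -> E -> X,
  (forall x : E, `|x| <= K ->
    (fun z : E * E => G z.2 z.1) @ (x, p0) --> e p0 (plane x)) /\
  \forall p \near p0, transport p0 p K (G p).
Proof.
move=> bK; pose M := K + 1; have KM : K < M by rewrite ltrDl.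
have [[e0 e_cont Fe eK cK] [c_cont h_cont k_cont k0]] := coordE p0.
pose phi (x p : E) := F a + h p0 (plane x) *: v p.
have phi_cont : continuous (fun xp : E * E => phi xp.1 xp.2).
  move=> [x p]; apply: cvgD; first exact: cvg_cst.
  apply: cvgZ; last first.
    apply: (@cvg_comp _ _ _ (fun z : E * E => z.2) v _ (nbhs p)); first exact: cvg_snd.
    exact: v_cont.
  apply: (@cvg_comp _ _ _ (fun z : E * E => z.1) (fun x => h p0 (plane x)) _ (nbhs x)).
    exact: cvg_fst.
  by apply: continuous_comp; [exact: plane_continuous|exact: h_cont].
have f_cont : continuous (fun x => e p0 (plane x)).
  by move=> x; apply: continuous_comp; [exact: plane_continuous|exact: e_cont].
have [G [Gjoint Gnear]] := @tube R X Y F F_open F_inj E E M _ phi p0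
  (@compact_plane_disc R M) f_cont phi_cont (fun x => esym (coord_Fe p0 (plane x))).
have Gj (x : E) : `|x| <= K ->
    (fun z : E * E => G z.2 z.1) @ (x, p0) --> e p0 (plane x).
  move=> xK O nO; have [A nA AO] := Gjoint x O (le_lt_trans xK KM) nO.
  by exists A.
have Gp (x : E) : `|x| <= K -> (fun p => G p x) @ p0 --> e p0 (plane x).
  move=> xK O nO; have [[A B] [/= nA nB] AB] := Gj x xK O nO.
  by apply: filterS nB => p Bp; apply: (AB (x, p)); split => //; exact: nbhs_singleton.
have K0 : 0 < K by exact: le_lt_trans bK.
have fixpt (x : E) y : `|x| <= K -> e p0 (plane x) = y -> F y = F a ->
    h p0 (plane x) = 0 -> \forall p \near p0, G p x = y.
  move=> xK ey Fy hx; have [U Uy Uinj] := F_inj y.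
  have n1 : \forall p \near p0, U (G p x).
    by apply: (Gp x xK); rewrite ey; exact: open_nbhs_nbhs.
  apply: filterS2 n1 Gnear => p Up /(_ x (le_lt_trans xK KM))[_ GF].
  apply: Uinj => //; first exact: nbhs_singleton (open_nbhs_nbhs Uy).
  by rewrite GF /phi hx scale0r addr0.
have G0 : \forall p \near p0, G p 0 = a.
  apply: fixpt => //; first by rewrite normr0 ltW.
  by rewrite /h mul0r.
have Gb : \forall p \near p0, G p (x_ p0) = b.
  apply: fixpt; [exact: ltW|by rewrite coordsK coord_eb|by []|].
  by rewrite coordsK; apply: coord_h; rewrite scale0r addr0.
have Ga : \forall p \near p0, [set x : E | `|x| <= K] `<=` (fun x : E =>
    F (G p x) = phi x p -> x != 0 -> G p x != a).
  have /compact_near_coveringP cov := @compact_plane_disc R K.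
  apply: (cov _ (nbhs p0)) => x xK.
  have [->|x0] := eqVneq x 0; last first.
    have ne : e p0 (plane x) != a.
      apply: contra_neq x0 => ea; apply/eqP; rewrite -plane_eq0.
      by rewrite -(eK (plane x)) ea coord_ca.
    have nO : nbhs (e p0 (plane x)) [set y | y != a].
      apply: open_nbhs_nbhs; split => //.
      rewrite (_ : [set y | y != a] = ~` [set a]); last first.
        by apply/seteqP; split => [y /eqP|y /eqP].
      apply: closed_openC; apply: accessible_closed_set1.
      exact: hausdorff_accessible.
    have [A nA AO] := Gj x xK _ nO.
    by exists A => // z /AO.
  have nk : \forall x \near (0 : E), k p0 (plane x) != 0.
    have : {for (0 : E), continuous (fun x => k p0 (plane x))}.
      by apply: continuous_comp; [exact: plane_continuous|exact: k_cont].
    by move=> /cvgr_neq0; apply; rewrite [plane 0](_ : _ = 0)// k0 oner_eq0.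
  exists ([set x | k p0 (plane x) != 0], setT); first by split => //; exact: filterT.
  move=> [y p] /= [ky _] GF y0; apply: contraNneq ky => Ga.
  move: GF; rewrite Ga /phi -[LHS]addr0 => /addrI/esym/eqP.
  by rewrite scaler_eq0 (negbTE (v_neq0 p)) orbF /h mulf_eq0 plane_eq0 (negbTE y0).
exists G; split => //.
apply: filterS2 (filterI G0 Gb) (filterI Ga Gnear) => p [p1 p2] [p3 p4].
split => // x xK; last by have := p4 x (lt_trans xK KM).
by apply: p3 => //; [exact: ltW|exact: (p4 x (lt_trans xK KM)).2].
Qed.

(** * Coordinate quotients and their square roots *)

(** The value at 0 is the limit of the quotient, since both coordinates are normalized to first
    order at [a]. *)
Definition ratio p (G : E -> X) (x : E) : C :=
  if x == 0 then 1 else c p (G x) / plane x.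

Lemma transport_coord_continuous p0 p K G (x : E) : transport p0 p K G ->
  `|x| < K -> {for x, continuous (fun y => c p (G y))}.
Proof.
move=> [_ _ _ GF] xK; have [Gx Fx] := GF x xK.
apply: (coord_c_cvg (nbhs_filter x) Fx Gx).
by apply: filterS (norm_open xK) => y /GF[_ ->]; eexists.
Qed.

Lemma ratioE p0 p K G (x : E) : transport p0 p K G -> `|x| < K ->
  c p (G x) = ratio p G x * plane x.
Proof.
move=> [G0 _ _ _] xK; rewrite /ratio; case: (eqVneq x 0) => [->|x0].
  by rewrite G0 coord_ca mulr0.
by rewrite divfK// plane_eq0.
Qed.

Lemma ratio_neq0 p0 p K G (x : E) : transport p0 p K G -> `|x| < K ->
  ratio p G x != 0.
Proof.
move=> [G0 _ Ga GF] xK; rewrite /ratio; case: (eqVneq x 0) => [_|x0].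
  by rewrite oner_eq0.
rewrite mulf_neq0 ?invr_eq0 ?plane_eq0//.
have [_ Fx] := GF x xK; apply: contra_neq (Ga x xK x0) => c0.
exact: coord_c_eq0 Fx c0.
Qed.

(** A transport preserves the parameter on the line: with u = [c p (G x)] and t = [plane x] this
    reads u * k p u = t * k p0 t. The resulting form of the quotient is continuous also at 0. *)
Lemma ratio_k p0 p K G (x : E) : transport p0 p K G -> `|x| < K ->
  k p (c p (G x)) != 0 -> ratio p G x = k p0 (plane x) / k p (c p (G x)).
Proof.
move=> tr xK kn0; have [G0 _ _ GF] := tr; have [_ Fx] := GF x xK.
have := coord_h Fx; rewrite /h => hE.
rewrite /ratio; case: (eqVneq x 0) => [x0|x0].
  have [_ [_ _ _ k0]] := coordE p; have [_ [_ _ _ k00]] := coordE p0.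
  by rewrite x0 G0 coord_ca k0 [plane 0](_ : _ = 0)// k00 divr1.
apply: (mulIf kn0); rewrite divfK// mulrAC hE mulrAC divff ?mul1r//.
by rewrite plane_eq0.
Qed.

Lemma ratio_continuous p0 p K G (x : E) : transport p0 p K G -> `|x| < K ->
  {for x, continuous (ratio p G)}.
Proof.
move=> tr xK; have cc := transport_coord_continuous tr xK.
have [x0|x0] := eqVneq x 0; last first.
  apply: (@near_eq_continuous_at _ _ (fun y => c p (G y) / plane y)).
    have : \forall y \near x, plane y != 0.
      by apply: cvgr_neq0 (@plane_continuous R x) _; rewrite plane_eq0.
    by apply: filterS => y; rewrite plane_eq0 /ratio => /negbTE ->.
  apply: continuous_atM; first exact: cc.
  apply: continuous_atV; first by rewrite plane_eq0.
  exact: plane_continuous.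
have [G0 _ _ _] := tr.
have [_ [_ _ k_cont k0]] := coordE p; have [_ [_ _ k0_cont k00]] := coordE p0.
have ck : {for x, continuous (fun y => k p (c p (G y)))}.
  apply: (@continuous_comp _ _ _ (fun y => c p (G y)) (k p)); first exact: cc.
  have -> : c p (G x) = 0 by rewrite x0 G0 coord_ca.
  exact: k_cont.
have kx : k p (c p (G x)) != 0 by rewrite x0 G0 coord_ca k0 oner_eq0.
apply: (@near_eq_continuous_at _ _ (fun y => k p0 (plane y) / k p (c p (G y)))).
  have n1 := norm_open xK.
  have n2 : \forall y \near x, k p (c p (G y)) != 0 by exact: cvgr_neq0 ck kx.
  by apply: filterS2 n1 n2 => y yK ky; rewrite (ratio_k tr).
apply: continuous_atM; last exact: continuous_atV.
apply: continuous_comp; first exact: plane_continuous.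
have -> : plane x = 0 by rewrite x0.
exact: k0_cont.
Qed.

(* [m] is the square root, normalized at [a], of the coordinate quotient. *)
Definition transport_sqrt p0 p K (m : E -> C) := exists G,
  [/\ transport p0 p K G, m 0 = 1 & forall x : E, `|x| < K ->
    {for x, continuous m} /\ c p (G x) = m x ^+ 2 * plane x].

Lemma transport_sqrt_exists p0 K : `|x_ p0| < K ->
  \forall p \near p0, exists m, transport_sqrt p0 p K m.
Proof.
move=> bK; have KM : K < K + 1 by rewrite ltrDl.
have [G [_ Gnear]] := transport_exists (lt_trans bK KM).
apply: filterS Gnear => p tr.
have [||x xM|m [m0 mP]] := @continuous_sqrt R (ratio p (G p)) K (K + 1) _ KM.
- exact: le_lt_trans bK.
- by rewrite /ratio eqxx.
- by split; [exact: ratio_continuous tr xM|exact: ratio_neq0 tr xM].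
exists m, (G p); split => //; first exact: transport_le (ltW KM) tr.
move=> x xK; have [mc ->] := mP x xK; split => //.
exact: ratioE tr (lt_trans xK KM).
Qed.

(** The transport fixes [b], whose coordinates are [tau p0] and [tau p]; so [m (x_ p0)] carries
    square roots of [tau p0] to square roots of [tau p]. *)
Lemma transport_sqrt_tau p0 p K m : `|x_ p0| < K -> transport_sqrt p0 p K m ->
  m (x_ p0) ^+ 2 * tau p0 = tau p.
Proof.
move=> bK [G [[_ Gb _ _] _ /(_ _ bK)[_]]].
by rewrite Gb coordsK => <-.
Qed.

Lemma transport_sqrt_neq0 p0 p K m (x : E) : `|x| < K ->
  transport_sqrt p0 p K m -> m x != 0.
Proof.
move=> xK [G [tr m0 /(_ _ xK)[_ mE]]].
have [->|x0] := eqVneq x 0; first by rewrite m0 oner_eq0.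
apply: contra_neq (ratio_neq0 tr xK) => mx.
by rewrite /ratio (negbTE x0) mE mx expr0n !mul0r.
Qed.

(* Both sides are square roots, along the segment from 0 to [x_ p0], of the
   coordinate over [v p2] of the same lift, and both are 1 at 0. *)
Lemma transport_sqrt_comp p0 p1 p2 K0 K1 m01 m02 m12 : `|x_ p0| < K0 ->
  transport_sqrt p0 p1 K0 m01 -> transport_sqrt p0 p2 K0 m02 ->
  transport_sqrt p1 p2 K1 m12 ->
  (forall s : R, 0 <= s <= 1 ->
     `|coords (m01 (s *: x_ p0) ^+ 2 * plane (s *: x_ p0))| < K1) ->
  m02 (x_ p0) = m12 (x_ p1) * m01 (x_ p0).
Proof.
set x0 := x_ p0.
move=> bK sq01 sq02 [G12 [tr12 m120 m12P]] bound.
have [G01 [tr01 m010 m01P]] := sq01; have [G02 [tr02 m020 m02P]] := sq02.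
have [G010 G01b _ G01F] := tr01; have [G020 _ _ G02F] := tr02.
have [G120 _ _ G12F] := tr12.
pose l (s : R) : E := s *: x0.
have l_cont : continuous l by move=> s; apply: cvgZr_tmp; exact: cvg_id.
have lK s : 0 <= s <= 1 -> `|l s| < K0.
  move=> /andP[s0 s1]; rewrite normrZ ger0_norm//.
  by apply: le_lt_trans bK; rewrite ler_piMl.
(* The first transport traces this path in the coordinate over [v p1]. It ends at [tau p1], and
   [bound] keeps it in the disc of the second transport. *)
pose u s := c p1 (G01 (l s)).
pose y s : E := coords (u s).
have u_cont s : 0 <= s <= 1 -> {for s, continuous u}.
  move=> /lK sK; apply: (@continuous_comp _ _ _ l (fun x => c p1 (G01 x))).
    exact: l_cont.
  exact: transport_coord_continuous tr01 sK.
have y_cont s : 0 <= s <= 1 -> {for s, continuous y}.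
  move=> s01; apply: (@continuous_comp _ _ _ u (@coords R)); first exact: u_cont.
  exact: coords_continuous.
have yK s : 0 <= s <= 1 -> `|y s| < K1.
  by move=> s01; rewrite /y /u (m01P _ (lK _ s01)).2; exact: bound.
have near_l (s : R) : 0 <= s <= 1 -> \forall t \near s, `|l t| < K0.
  move=> /lK sK; apply: (l_cont s [set z : E | `|z| < K0]).
  exact: norm_open.
have near_y (s : R) : 0 <= s <= 1 -> \forall t \near s, `|y t| < K1.
  move=> s01; apply: (y_cont s s01 [set z : E | `|z| < K1]).
  by apply: norm_open; exact: yK.
have G02_cont s : 0 <= s <= 1 -> {for s, continuous (fun t => G02 (l t))}.
  move=> s01; apply: (@continuous_comp _ _ _ l G02); first exact: l_cont.
  exact: (G02F _ (lK _ s01)).1.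
have G12_cont s : 0 <= s <= 1 -> {for s, continuous (fun t => G12 (y t))}.
  move=> s01; apply: (@continuous_comp _ _ _ y G12); first exact: y_cont.
  exact: (G12F _ (yK _ s01)).1.
have F_eq (s : R) : 0 <= s <= 1 -> \forall t \near s, F (G02 (l t)) = F (G12 (y t)).
  move=> s01; apply: filterS2 (near_l s s01) (near_y s s01) => t lt yt.
  rewrite (G02F _ lt).2 (G12F _ yt).2 coordsK.
  by rewrite (coord_h (G01F _ lt).2).
have y0 : y 0 = 0 by rewrite /y /u /l scale0r G010 coord_ca.
(* The direct and the composite transport of the segment lift the same path and both start at
   [a]. *)
have G_eq (s : R) : 0 <= s <= 1 -> G02 (l s) = G12 (y s).
  apply: (@lift_unique R X Y F X_hausdorff F_inj
    (fun t => G02 (l t)) (fun t => G12 (y t))).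
    by move=> t t01; split; [exact: G02_cont|exact: G12_cont|exact: F_eq].
  by rewrite y0 G120 /l scale0r G020.
have near_G (s : R) : 0 <= s <= 1 -> \forall t \near s, G02 (l t) = G12 (y t).
  move=> s01; apply: (near_lift_eq F_inj (G02_cont s s01) (G12_cont s s01)).
    exact: F_eq.
  exact: G_eq.
have := @sqrt_unique R C (fun s => m02 (l s)) (fun s => m12 (y s) * m01 (l s)).
rewrite /= y0 /l scale0r m020 m120 m010 mulr1 scale1r.
have -> : y 1 = x_ p1 by rewrite /y /u /l scale1r G01b.
apply; last by [].
move=> s s01; split.
- apply: (@continuous_comp _ _ _ l m02); first exact: l_cont.
  exact: (m02P _ (lK _ s01)).1.
- apply: continuous_atM.
    apply: (@continuous_comp _ _ _ y m12); first exact: y_cont.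
    exact: (m12P _ (yK _ s01)).1.
  apply: (@continuous_comp _ _ _ l m01); first exact: l_cont.
  exact: (m01P _ (lK _ s01)).1.
- exact: transport_sqrt_neq0 (lK _ s01) sq02.
apply: filterS3 (near_G s s01) (near_l s s01) (near_y s s01) => t Gt lt yt.
suff : m02 (l t) ^+ 2 = (m12 (y t) * m01 (l t)) ^+ 2 by [].
have [lt0|lt0] := eqVneq (l t) 0.
  by rewrite /y /u lt0 G010 coord_ca m020 m120 m010 mulr1.
rewrite -plane_eq0 in lt0; apply: (mulIf lt0).
suff : m02 (l t) ^+ 2 * plane (l t) = (m12 (y t) * m01 (l t)) ^+ 2 * plane (l t) by [].
rewrite exprMn -[RHS]mulrA -(m02P _ lt).2 -(m01P _ lt).2 Gt (m12P _ yt).2.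
by rewrite coordsK.
Qed.

(** * Parallel square roots of [tau] *)

(* [S] is parallel at [p1] for the transport of square roots of [tau]. *)
Definition flat (S : E -> C) p1 := exists K : R, forall K1, K <= K1 ->
  \forall p2 \near p1, forall m, transport_sqrt p1 p2 K1 m ->
    S p2 = m (x_ p1) * S p1.

(** [transport_sqrt_comp] applies once the radius over [p1] exceeds the coordinates of the
    transported segment; by compactness of [0, 1] these are bounded, with maximum [g t]. *)
Lemma transport_sqrt_flat p0 K0 s S p1 : `|x_ p0| < K0 ->
  (\forall p \near p1, exists2 m, transport_sqrt p0 p K0 m & S p = m (x_ p0) * s) ->
  flat S p1.
Proof.
move=> bK SP; have [m01 sq01 Sp1] := nbhs_singleton SP.
have [G01 [tr01 m010 m01P]] := sq01.
pose l (s : R) : E := s *: x_ p0.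
have l_cont : continuous l by move=> t; apply: cvgZr_tmp; exact: cvg_id.
pose g (s : R) : R := `|coords (m01 (l s) ^+ 2 * plane (l s))|.
have [t _ tmax] : exists2 t, t \in `[0, 1] & forall s, s \in `[0, 1] -> g s <= g t.
  apply: EVT_max => //; apply: continuous_in_subspaceT => t.
  rewrite inE /= in_itv /= => /andP[t0 t1].
  have lK : `|l t| < K0.
    by apply: le_lt_trans bK; rewrite normrZ ger0_norm// ler_piMl.
  apply: (@continuous_comp _ _ _ (fun s => coords (m01 (l s) ^+ 2 * plane (l s)))
    (fun z : E => `|z|)); last exact: norm_continuous.
  apply: (@continuous_comp _ _ _ (fun s => m01 (l s) ^+ 2 * plane (l s)) (@coords R));
    last exact: coords_continuous.
  have cm : {for t, continuous (fun s => m01 (l s))}.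
    apply: (@continuous_comp _ _ _ l m01); first exact: l_cont.
    exact: (m01P _ lK).1.
  apply: continuous_atM; first exact: continuous_atM.
  apply: (@continuous_comp _ _ _ l (@plane R)); first exact: l_cont.
  exact: plane_continuous.
exists (g t + 1) => K1 gK1.
apply: filterS SP => p2 [m02 sq02 ->] m12 sq12.
rewrite Sp1 mulrA; congr (_ * _).
apply: (transport_sqrt_comp bK sq01 sq02 sq12) => r r01.
apply: lt_le_trans gK1; apply: (@le_lt_trans _ _ (g t)); last by rewrite ltrDl.
by apply: tmax; rewrite in_itv.
Qed.

(** At a radius large enough for both sections and for [x_ p1], one and the same factor [m (x_ p1)]
    moves [S] and [S']. *)
Lemma flat_compat S S' p1 : flat S p1 -> flat S' p1 ->
  \forall p2 \near p1, S p2 * S' p1 = S' p2 * S p1.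
Proof.
move=> [K KP] [K' KP'].
pose K1 := Num.max (Num.max K K') (`|x_ p1| + 1).
have K1K : K <= K1 by rewrite !le_max lexx.
have K1K' : K' <= K1 by rewrite !le_max lexx orbT.
have bK : `|x_ p1| < K1 by rewrite lt_max ltrDl ltr01 orbT.
apply: filterS3 (KP K1 K1K) (KP' K1 K1K') (transport_sqrt_exists bK) => p2 Sp Sp' [m sq].
by rewrite (Sp m sq) (Sp' m sq) mulrAC.
Qed.

Lemma flat_sqr S p1 : flat S p1 ->
  \forall p2 \near p1, S p2 ^+ 2 * tau p1 = tau p2 * S p1 ^+ 2.
Proof.
move=> [K KP]; pose K1 := Num.max K (`|x_ p1| + 1).
have K1K : K <= K1 by rewrite !le_max lexx.
have bK : `|x_ p1| < K1 by rewrite lt_max ltrDl ltr01 orbT.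
apply: filterS2 (KP K1 K1K) (transport_sqrt_exists bK) => p2 Sp [m sq].
by rewrite (Sp m sq) exprMn -(transport_sqrt_tau bK sq) mulrAC.
Qed.

(** Around each [p0] the transports of a square root of [tau p0] form a flat section, and flat
    sections are locally proportional, so [monodromy] applies. Flatness passes to [T], which near
    [p] is proportional to [S p]. *)
Lemma flat_global (M : R) : exists T : E -> C, forall p, `|p| < M ->
  T p != 0 /\ flat T p.
Proof.
have /choice[N NP] : forall p0, exists N : set E, open_nbhs (p0 : E) N /\
    forall p, N p -> exists m, transport_sqrt p0 p (`|x_ p0| + 1) m.
  move=> p0; have bK : `|x_ p0| < `|x_ p0| + 1 by rewrite ltrDl.
  exists [set p | exists m, transport_sqrt p0 p (`|x_ p0| + 1) m]°; split.
    by split; [exact: open_interior|exact: transport_sqrt_exists bK].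
  by move=> p /nbhs_singleton.
have /choice[S SP] : forall p0, exists S : E -> C, forall p, N p0 p ->
    exists2 m, transport_sqrt p0 p (`|x_ p0| + 1) m &
      S p = m (x_ p0) * sqrtc (tau p0).
  move=> p0; have [_ Np] := NP p0.
  (* The roots [m] are chosen for each [p] on its own, without continuity in [p]. *)
  have /choice[m mP] : forall p, exists m, N p0 p ->
      transport_sqrt p0 p (`|x_ p0| + 1) m.
    move=> p; have [/Np[m sq]|nN] := pselect (N p0 p); first by exists m.
    by exists (fun=> 0).
  by exists (fun p => m p (x_ p0) * sqrtc (tau p0)) => p /mP sq; exists (m p).
have Sflat p0 p1 : N p0 p1 -> flat (S p0) p1.
  move=> Np; apply: (@transport_sqrt_flat p0 (`|x_ p0| + 1) (sqrtc (tau p0))).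
    by rewrite ltrDl.
  apply: (@filterS _ _ (nbhs_filter p1) _ _ (SP p0)).
  by apply: open_nbhs_nbhs; split => //; exact: (NP p0).1.1.
have S0 p0 p : N p0 p -> S p0 p != 0.
  move=> /SP[m sq ->]; rewrite mulf_neq0//.
    by apply: transport_sqrt_neq0 sq; rewrite ltrDl.
  by rewrite sqrtc_eq0 tau_neq0.
have [|||||T [T0 TS]] := @monodromy R E C M N S.
- exact: compact_plane_disc.
- by move=> p; exact: (NP p).1.1.
- by move=> p _; exact: (NP p).1.2.
- exact: S0.
- by move=> p p' q Np Np'; apply: flat_compat; exact: Sflat.
exists T => p pM; split; first exact: T0.
have Npp : N p p := (NP p).1.2.
have [K KP] := Sflat p p Npp.
exists K => K1 KK1.
apply: filterS2 (KP K1 KK1) (TS p pM) => p2 Sp Tp m sq.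
apply: (mulIf (S0 _ _ Npp)); rewrite Tp (Sp m sq) mulrA; congr (_ * _).
exact: mulrC.
Qed.

(** * Directions on one line *)

(* Over a single line, the chosen coordinates depend homogeneously on [p]. *)
Hypothesis homogeneous : forall p p' : E, 1 <= `|p| -> 1 <= `|p'| ->
  [/\ v p = (plane p / plane p') *: v p',
      forall x, c p x = c p' x * (plane p' / plane p) &
      forall t, k p t = k p' (plane p / plane p' * t)].

Lemma nbhs_neq (x y : X) : x != y -> nbhs x [set z | z != y].
Proof.
move=> xy; apply: open_nbhs_nbhs; split => //.
rewrite (_ : [set z | z != y] = ~` [set y]); last first.
  by apply/seteqP; split => [z /eqP|z /eqP].
apply: closed_openC; apply: accessible_closed_set1.
exact: hausdorff_accessible.
Qed.

Lemma ge1_plane_neq0 (p : E) : 1 <= `|p| -> plane p != 0.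
Proof.
move=> p1; rewrite plane_eq0; apply: contraTneq p1 => ->.
by rewrite normr0 -ltNge ltr01.
Qed.

(* For directions on one line the coordinate quotient is close to 1 on the whole
   disc, so its square root is the principal one. *)
Lemma transport_sqrt_line p0 K : 1 < `|p0| -> `|x_ p0| < K ->
  \forall p \near p0, exists2 m, transport_sqrt p0 p K m &
    0 < complex.Re (m (x_ p0)).
Proof.
move=> p01 bK; have KM : K < K + 1 by rewrite ltrDl.
have [G [Gj Gnear]] := transport_exists (lt_trans bK KM).
have p1near : \forall p \near p0, 1 < `|p|.
  apply: (@norm_continuous _ _ p0 [set r | 1 < r]).
  by apply: open_nbhs_nbhs; split => //; exact: open_gt.
have pl0 := ge1_plane_neq0 (ltW p01).
have Wpos : \forall p \near p0, [set x : E | `|x| <= K] `<=`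
    (fun x : E => 0 < complex.Re (ratio p (G p) x)).
  have /compact_near_coveringP cov := @compact_plane_disc R K.
  apply: (cov _ (nbhs p0)) => x0 x0K.
  pose z0 : E * E := (x0, p0); pose g (z : E * E) := G z.2 z.1.
  have x0M : `|x0| <= K + 1 by exact: le_trans (ltW KM).
  have gz0 : g z0 = e p0 (plane x0).
    apply/eqP; rewrite eq_sym; apply/negP => /negP ne.
    by have := nbhs_singleton (Gj x0 x0M _ (nbhs_neq ne)); rewrite /= eqxx.
  have g_cont : {for z0, continuous g}.
    by change (g @ z0 --> g z0); rewrite gz0; exact: Gj.
  have good : \forall z \near z0, [/\ `|z.1| < K + 1,
      transport p0 z.2 (K + 1) (G z.2) & 1 < `|z.2|].
    exists ([set x : E | `|x| < K + 1],
      [set p | transport p0 p (K + 1) (G p) /\ 1 < `|p|]) => /=.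
      split; first by apply: norm_open; exact: le_lt_trans KM.
      exact: filterI.
    by move=> [x p] /= [xM [tr p1]].
  have fst_cont : {for z0, continuous (fun z : E * E => plane z.1)}.
    apply: (@continuous_comp _ _ _ (fun z : E * E => z.1) (@plane R)).
      exact: cvg_fst.
    exact: plane_continuous.
  have snd_cont : {for z0, continuous (fun z : E * E => plane z.2)}.
    apply: (@continuous_comp _ _ _ (fun z : E * E => z.2) (@plane R)).
      exact: cvg_snd.
    exact: plane_continuous.
  have cz0 : c p0 (g z0) = plane x0.
    by rewrite gz0; case: (coordE p0) => -[].
  have c_cont : {for z0, continuous (fun z => c p0 (g z))}.
    apply: (coord_c_cvg (nbhs_filter z0) _ g_cont); first by rewrite gz0 coord_Fe.
    apply: filterS good => z [zM [_ _ _ /(_ _ zM)[_ Fz]] z1].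
    have [vE _ _] := homogeneous (ltW z1) (ltW p01).
    by rewrite vE scalerA in Fz; eexists; exact: Fz.
  (* Away from [x0 = 0], [W] replaces [c p] by a multiple of [c p0], thanks to homogeneity; at 0 it
     is the expression of [ratio_k]. *)
  suff [W [W_cont Wz0 WE]] : exists W : E * E -> C, [/\ {for z0, continuous W},
      W z0 = 1 & \forall z \near z0, ratio z.2 (G z.2) z.1 = W z].
    have pos : \forall z \near z0, 0 < complex.Re (W z).
      apply: (W_cont [set w | 0 < complex.Re w]); apply: near_Re_gt0.
      by rewrite Wz0 ltr01.
    have [[A B] nAB AB] : \forall z \near z0, 0 < complex.Re (ratio z.2 (G z.2) z.1).
      by apply: filterS2 WE pos => z ->.
    by exists (A, B).
  have [x00|x00] := eqVneq x0 0; last first.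
    have px0 : plane x0 != 0 by rewrite plane_eq0.
    exists (fun z => c p0 (g z) * (plane p0 / plane z.2) / plane z.1); split.
    - apply: continuous_atM; last by apply: continuous_atV; [exact: px0|exact: fst_cont].
      apply: continuous_atM; first exact: c_cont.
      apply: continuous_atM; first exact: continuous_at_cst.
      by apply: continuous_atV; [exact: pl0|exact: snd_cont].
    - by rewrite cz0 /= divff// mulr1 divff.
    have nz : \forall z \near z0, plane z.1 != 0 by exact: cvgr_neq0 fst_cont px0.
    apply: filterS2 good nz => z [zM _ z1]; rewrite plane_eq0 /ratio => /negbTE ->.
    by have [_ -> _] := homogeneous (ltW z1) (ltW p01).
  have [_ [_ _ k_cont k0]] := coordE p0.
  have kc : {for z0, continuous (fun z => k p0 (c p0 (g z)))}.
    apply: (@continuous_comp _ _ _ (fun z => c p0 (g z)) (k p0)); first exact: c_cont.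
    have -> : c p0 (g z0) = 0 by rewrite cz0 x00.
    exact: k_cont.
  have kc0 : k p0 (c p0 (g z0)) = 1 by rewrite cz0 x00 -[RHS]k0.
  have kc_neq0 : k p0 (c p0 (g z0)) != 0 by rewrite kc0 oner_eq0.
  exists (fun z => k p0 (plane z.1) / k p0 (c p0 (g z))); split.
  - apply: continuous_atM; last by apply: continuous_atV; [exact: kc_neq0|exact: kc].
    apply: (@continuous_comp _ _ _ (fun z : E * E => plane z.1) (k p0)).
      exact: fst_cont.
    have -> : plane z0.1 = 0 by rewrite /= x00.
    exact: k_cont.
  - by rewrite kc0 divr1 /= x00 -[RHS]k0.
  have nz : \forall z \near z0, k p0 (c p0 (g z)) != 0 by exact: cvgr_neq0 kc kc_neq0.
  apply: filterS2 good nz => z [zM tr z1] kz.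
  have kE : k z.2 (c z.2 (g z)) = k p0 (c p0 (g z)).
    have [_ cE kE] := homogeneous (ltW z1) (ltW p01).
    rewrite kE cE mulrCA mulf_div mulrC [X in X / _]mulrC divff ?mul1r//.
    by rewrite mulf_neq0 ?ge1_plane_neq0 ?ltW.
  by rewrite -kE (ratio_k tr)// kE.
apply: filterS2 Gnear Wpos => p tr pos.
exists (fun x => psqrt (ratio p (G p) x)); last first.
  by apply: psqrt_gt0; apply: pos; exact: ltW.
exists (G p); split; first exact: transport_le (ltW KM) tr.
  rewrite /ratio eqxx; apply: psqrt_uniq; rewrite ?sqr_psqrt ?expr1n ?psqrt_gt0 ?ltr01//.
move=> x xK; have xM := lt_trans xK KM; split.
  apply: (@continuous_comp _ _ _ (ratio p (G p)) (@psqrt R)).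
    exact: ratio_continuous tr xM.
  by apply: psqrt_continuous; apply: pos; exact: ltW.
by rewrite sqr_psqrt; exact: ratioE tr xM.
Qed.

Lemma tau_line (p p' : E) : 1 <= `|p| -> 1 <= `|p'| ->
  tau p * plane p = tau p' * plane p'.
Proof.
move=> p1 p1'; have [_ cE _] := homogeneous p1 p1'.
by rewrite /tau cE -mulrA divfK// ge1_plane_neq0.
Qed.

Lemma planeN (p : E) : plane (- p) = - plane p.
Proof. by []. Qed.

(** The factor that moves [S] has positive real part and square [tau p' / tau p], which is
    [plane p / plane p'] on the line: [S] varies like a continuous square root of 1 / plane. *)
Lemma flat_line S p : 1 < `|p| -> flat S p -> S p != 0 ->
  \forall p' \near p, exists2 m, S p' = m * S p &
    0 < complex.Re m /\ m ^+ 2 * plane p' = plane p.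
Proof.
move=> p1 [K KP] Sp0; pose K1 := Num.max K (`|x_ p| + 1).
have K1K : K <= K1 by rewrite !le_max lexx.
have bK : `|x_ p| < K1 by rewrite lt_max ltrDl ltr01 orbT.
have p1near : \forall p' \near p, 1 < `|p'|.
  apply: (@norm_continuous _ _ p [set r | 1 < r]).
  by apply: open_nbhs_nbhs; split => //; exact: open_gt.
apply: filterS3 (KP K1 K1K) (transport_sqrt_line p1 bK) p1near => p' Sp [m sq mpos] p1'.
exists (m (x_ p)); first exact: Sp.
split => //; apply: (mulfI (tau_neq0 p)).
rewrite -(tau_line (ltW p1') (ltW p1)) -(transport_sqrt_tau bK sq).
by rewrite mulrCA mulrA.
Qed.

(** The square of a flat [T] is proportional to [tau], which is odd where |p| > 1. So T p / T (- p)
    has square -1 there, while it is constant along a path that joins a point to its opposite. *)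
Lemma no_fiber_coordinate_family : False.
Proof.
(* The radius 4 leaves room for the path used below, of norm at most 3. *)
have [T TP] := flat_global 4.
have T0 p : `|p| < 4 -> T p != 0 by case/TP.
have Tflat p : `|p| < 4 -> flat T p by case/TP.
have sqr p : `|p| < 4 -> T p ^+ 2 * tau 0 = tau p * T 0 ^+ 2.
  move=> p4; have := @locally_constant_01 R
    (fun s => T (s *: p) ^+ 2 * tau 0 = tau (s *: p) * T 0 ^+ 2).
  rewrite /= scale1r scale0r; apply; last by rewrite mulrC.
  move=> s /andP[s0 s1].
  have sp4 : `|s *: p| < 4 by rewrite normrZ ger0_norm// (le_lt_trans _ p4)// ler_piMl.
  have cc : (fun t : R => t *: p) @ s --> s *: p by apply: cvgZr_tmp; exact: cvg_id.
  have n1 : \forall t \near s, T (t *: p) ^+ 2 * tau (s *: p) =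
      tau (t *: p) * T (s *: p) ^+ 2.
    exact: (cc _ (flat_sqr (Tflat _ sp4))).
  have n2 : \forall t \near s, `|t *: p| < 4 by exact: (cc _ (norm_open sp4)).
  apply: filterS2 n1 n2 => t tE /T0 Tt0.
  apply: cross_mul tE; rewrite sqrf_eq0; last exact: Tt0.
  exact: T0.
have opp p : 1 < `|p| -> `|p| < 4 -> T p ^+ 2 = - T (- p) ^+ 2.
  move=> p1 p4; have p4' : `|- p| < 4 by rewrite normrN.
  have p1' : 1 < `|- p| by rewrite normrN.
  have tauN : tau p = - tau (- p).
    apply: (mulIf (ge1_plane_neq0 (ltW p1))).
    by rewrite (tau_line (ltW p1) (ltW p1')) planeN mulrN mulNr.
  apply: (mulIf (tau_neq0 0)); rewrite sqr// mulNr sqr// tauN.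
  exact: mulNr.
have compat p : 1 < `|p| -> `|p| < 4 ->
    \forall q \near p, T q * T (- p) = T (- q) * T p.
  move=> p1 p4; have p4' : `|- p| < 4 by rewrite normrN.
  have p1' : 1 < `|- p| by rewrite normrN.
  have n1 := flat_line p1 (Tflat p p4) (T0 p p4).
  have n2 := flat_line p1' (Tflat _ p4') (T0 _ p4').
  have opp_cont : (fun q : E => - q) @ p --> - p by apply: cvgN; exact: cvg_id.
  have n3 : \forall q \near p, exists2 m, T (- q) = m * T (- p) &
      0 < complex.Re m /\ m ^+ 2 * plane (- q) = plane (- p).
    exact: opp_cont _ n2.
  apply: filterS2 n1 n3 => q [m Tq [mpos mE]] [m' Tq' [mpos' mE']].
  have q0 : plane q != 0.
    by apply: contra_neq (ge1_plane_neq0 (ltW p1)) => q0; rewrite -mE q0 mulr0.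
  (* Both are the root with positive real part of [plane p / plane q]. *)
  have mm : m = m'.
    apply: psqrt_uniq => //; apply: (mulIf q0); apply: oppr_inj.
    by rewrite mE -planeN -mE' planeN mulrN.
  by rewrite Tq Tq' mm mulrAC.
have seg p q : (forall s : R, 0 <= s <= 1 -> 1 < `|p + s *: (q - p)| < 4) ->
    T q * T (- p) = T (- q) * T p.
  move=> pq; pose l (s : R) : E := p + s *: (q - p).
  have l_cont : continuous l.
    by move=> s; apply: cvgD; [exact: cvg_cst|apply: cvgZr_tmp; exact: cvg_id].
  have l1 : l 1 = q by rewrite /l scale1r addrC subrK.
  have l0 : l 0 = p by rewrite /l scale0r addr0.
  rewrite -l1; apply: (@locally_constant_01 R
    (fun s => T (l s) * T (- p) = T (- l s) * T p)); last by rewrite l0 mulrC.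
  move=> s /pq /andP[s1 s4].
  have n1 : \forall t \near s, T (l t) * T (- l s) = T (- l t) * T (l s).
    exact: (l_cont s _ (compat (l s) s1 s4)).
  have n2 : \forall t \near s, `|l t| < 4 by exact: (l_cont s _ (norm_open s4)).
  apply: filterS2 n1 n2 => t tE t4.
  by apply: cross_mul tE; exact: T0.
(* [T p / T (- p)] squares to -1, is constant along the two segments from
   [(r, 0)] through [(0, r)] to [(- r, 0)], and is inverted by [p |-> - p]. *)
pose r : R := 3.
(* The sup norm on this segment is at least r / 2, hence above 1. *)
have norm_seg (x y s : R) : `|x| = r -> `|y| = r -> 0 <= s <= 1 ->
    1 < `|(x, 0) + s *: ((0, y) - (x, 0)) : E| < 4.
  move=> xr yr /andP[s0 s1].
  have -> : (x, 0) + s *: ((0, y) - (x, 0)) = ((1 - s) * x, s * y) :> E.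
    by congr (_, _) => /=; rewrite ?sub0r ?subr0 ?add0r// mulrBl mul1r -mulrN.
  rewrite prod_normE /= !normrM xr yr (ger0_norm s0) ger0_norm ?subr_ge0//.
  rewrite lt_max gt_max /r; apply/andP; split; last by apply/andP; split; lra.
  by have [s2|s2] := leP s (1/2); apply/orP; [left|right]; lra.
have normr_r : `|r| = r by rewrite ger0_norm.
have e1 := seg (r, 0) (0, r) (fun s => norm_seg r r s normr_r normr_r).
have e2 : T (- (r, 0)) * T (- (0, r)) = T (r, 0) * T (0, r).
  rewrite -[X in _ = T X * _]opprK; apply: seg => s s01.
  rewrite (_ : (0, r) + s *: (- (r, 0) - (0, r)) =
    - ((r, 0) + (1 - s) *: ((0, - r) - (r, 0)))); last first.
    by congr (_, _) => /=; rewrite /GRing.scale /=; ring.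
  by rewrite normrN norm_seg ?normrN//; lra.
have r14 : 1 < `|(r, 0) : E| < 4.
  by have := norm_seg r r 0 normr_r normr_r; rewrite scale0r addr0;
    apply; rewrite lexx ler01.
have [r1 r4] := andP r14.
have A0 := T0 _ r4.
have A'0 : T (- (r, 0)) != 0 by apply: T0; rewrite normrN.
have B0 : T (0, r) != 0.
  apply: T0; have := norm_seg r r 1 normr_r normr_r; rewrite scale1r addrC subrK.
  by rewrite lexx ler01 => /(_ isT)/andP[].
have : T (r, 0) ^+ 2 = T (- (r, 0)) ^+ 2.
  apply: (mulfI B0); rewrite !expr2 !mulrA e1.
  by rewrite [RHS]mulrC mulrA e2 [T (0, r) * _]mulrC.
rewrite opp// => /esym/eqP; rewrite -addr_eq0 -mulr2n mulrn_eq0 sqrf_eq0.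
by rewrite (negbTE A'0).
Qed.

End Transport.

(** * Coordinates on the fibers *)

Section LeftInverse.
Variables (K : numFieldType) (V : normedModType K).

Lemma affine_continuous (w x : V) : continuous (fun t : K => t *: w + x).
Proof.
move=> t.
apply: (@continuous_atD K K V (fun h => h *: w) (fun _ => x)).
  apply: (@continuous_atZ K K V id (fun _ => w)); first exact: cvg_id.
  exact: continuous_at_cst.
exact: continuous_at_cst.
Qed.

(** By the chain rule the derivative of [psi] undoes that of [eta], which therefore does not kill
    [w]; [d] is the inverse of the derivative along [w]. *)
Lemma normalized_derivative (eta : V -> K) (psi : K -> V) (x w : V) :
  w != 0 -> differentiable eta x -> differentiable psi (eta x) ->
  (\forall y \near x, psi (eta y) = y) ->
  exists2 d : K, d != 0 &
    t^-1 * (eta (t *: (d *: w) + x) - eta x) @[t --> 0^'] --> (1 : K).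
Proof.
move=> w0 deta dpsi psiK.
have dcomp : differentiable (psi \o eta) x by exact: differentiable_comp.
have l1 : (fun h : K => h^-1 *: (psi (eta (h *: w + x)) - psi (eta x))) @ 0^' -->
    'd (psi \o eta) x w.
  by rewrite -deriveE//; exact: (@diff_derivable _ _ _ _ x w dcomp).
have l2 : (fun h : K => h^-1 *: (psi (eta (h *: w + x)) - psi (eta x))) @ 0^' --> w.
  apply: (@cvg_trans _ ((fun _ : K => w) @ 0^')); last exact: cvg_cst.
  apply: near_eq_cvg.
  have lc : (fun h : K => h *: w + x) @ (0 : K) --> (0 : K) *: w + x.
    exact: affine_continuous.
  rewrite scale0r add0r in lc.
  have n1 : \forall h \near (0 : K), psi (eta (h *: w + x)) = h *: w + x.
    exact: lc _ psiK.
  have n2 : \forall h \near 0^', psi (eta (h *: w + x)) = h *: w + x.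
    exact: cvg_within n1.
  have n3 : \forall h \near 0^', h != 0 :> K by exact: nbhs_dnbhs_neq.
  apply: filterS2 n2 n3 => h -> h0.
  by rewrite (nbhs_singleton psiK) addrK scalerA mulVf// scale1r.
have Dw : 'd eta x w != 0.
  apply: contra_neq w0 => e0.
  have <- : 'd (psi \o eta) x w = w by exact: cvg_unique l1 l2.
  by rewrite diff_comp//= e0 linear0.
exists ('d eta x w)^-1; first by rewrite invr_eq0.
have der := @diff_derivable _ _ _ eta x (('d eta x w)^-1 *: w) deta.
have := der; rewrite /derivable => /cvg_ex[l lE].
have <- : 'D_(('d eta x w)^-1 *: w) eta x = 1.
  by rewrite deriveE// linearZ /= [X in X = _]mulVf.
exact: der.
Qed.

Lemma continuous_extend (f : K -> K) (y : K) :
  f t @[t --> 0^'] --> y -> {for 0, continuous (fun t => if t == 0 then y else f t)}.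
Proof.
move=> fy; change ((fun t => if t == 0 then y else f t) @ (0 : K) -->
  (if (0 : K) == 0 then y else f 0)).
rewrite eqxx => O nO.
have := fy O nO; rewrite /= => n1.
have n2 : nbhs (0 : K) [set t | t != 0 -> O (f t)] by exact: n1.
apply: filterS n2 => t /= Ot; case: eqVneq => [_|]; last exact: Ot.
exact: nbhs_singleton.
Qed.

Lemma affine_differentiable (w x : V) (t : K) :
  differentiable (fun t : K => x + t *: w) t.
Proof.
apply: differentiableD; first exact: differentiable_cst.
by apply: differentiableZl; exact: (@ex_diff _ _ _ _ _ _ _ (is_diff_id t)).
Qed.

Lemma coordinate_continuous (T : topologicalType) n (f : T -> 'rV[K]_n) z i (d : K) x :
  {for x, continuous f} -> {for x, continuous (fun t => (f t - z) 0 i / d)}.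
Proof.
move=> fc; apply: continuous_atM; last exact: continuous_at_cst.
apply: (@continuous_comp _ _ _ (fun t => f t - z) (fun w : 'rV[K]_n => w 0 i)).
  by apply: cvgB; [exact: fc|exact: cvg_cst].
exact: coord_continuous.
Qed.

Lemma coordinate_differentiable n (f : V -> 'rV[K]_n) z i (d : K) x :
  differentiable f x -> differentiable (fun t => (f t - z) 0 i / d) x.
Proof.
move=> df.
apply: (@differentiable_comp _ _ _ _ f (fun w : 'rV[K]_n => (w - z) 0 i / d)) => //.
rewrite (_ : (fun _ => _) = (fun w : 'rV[K]_n => w 0 i * d^-1 + (- z 0 i / d))); last first.
  by apply/funext => w; rewrite !mxE mulrDl.
apply: differentiableD; last exact: differentiable_cst.
apply: (@differentiableZl K _ _ (fun w : 'rV[K]_n => w 0 i) d^-1).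
exact: differentiable_coord.
Qed.

End LeftInverse.

Section LocalBiholomorphism.
Variable R : realType.
Local Notation C := R[i].
Variables (n : nat) (X : complex_manifold R n) (F : X -> 'rV[C]_n).
Hypothesis hF : local_biholomorphism X (complex_space R n) F.

Lemma local_biholomorphism_continuous : continuous F.
Proof. by move=> x; have [U [g [[_ Ux _] [_ hFU _]]]] := hF x; exact: (hFU x Ux).1. Qed.

Lemma local_biholomorphism_open x O : nbhs x O -> nbhs (F x) (F @` O).
Proof.
move=> nO; have [U [g [[oU Ux oFU] [FK _ hgU]]]] := hF x.
have gF y : U y -> g (F y) = y by move=> Uy; apply: FK; rewrite inE.
have FUx : (F @` U) (F x) by exists x.
have n1 : \forall y \near F x, O (g y).
  by apply: (hgU _ FUx).1; rewrite gF.
have n2 : \forall y \near F x, (F @` U) y by exact: open_nbhs_nbhs.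
by apply: filterS2 n1 n2 => z + [y Uy yz]; rewrite -yz gF// => Oy; exists y.
Qed.

Lemma local_biholomorphism_inj x : exists2 U, open_nbhs x U &
  forall y z, U y -> U z -> F y = F z -> y = z.
Proof.
have [U [g [[oU Ux _] [FK _ _]]]] := hF x; exists U => // y z Uy Uz Fyz.
by rewrite -(FK y) ?inE// Fyz FK ?inE.
Qed.

(** A local biholomorphism is tested on charts of the atlas; a chart of the maximal atlas, such as a
    slice chart, is reached through an atlas chart [d] at [x]. *)
Lemma differentiable_chart_inv (c : chart R X n) x : maximal_atlas X c ->
  chart_dom c x -> differentiable (F \o chart_inv c) (c x).
Proof.
move=> Ac cx; have [d Ad dx] := atlas_cover X x.
have [U [g [[_ Ux _] [_ hFU _]]]] := hF x.
have dF : differentiable (F \o chart_inv d) (d x).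
  by have [_ /(_ d (standard_chart R n) Ad erefl dx Logic.I)] := hFU x Ux.
apply: (@near_eq_differentiable _ _ _ ((F \o chart_inv d) \o (d \o chart_inv c))).
  have : \forall z \near c x, chart_dom d (chart_inv c z).
    apply: (chart_inv_cont (chart_map_cod cx)).
    by rewrite chart_mapK//; apply: open_nbhs_nbhs; split => //; exact: chart_dom_open.
  by apply: filterS => z dz /=; rewrite chart_mapK.
apply: differentiable_comp.
  by apply: (Ac _ Ad).1; [exact: chart_map_cod|rewrite chart_mapK].
have -> : (d \o chart_inv c) (c x) = d x by rewrite /= chart_mapK.
exact: dF.
Qed.

Lemma differentiable_local_inverse (c : chart R X n) x : maximal_atlas X c ->
  chart_dom c x -> exists g : 'rV[C]_n -> X,
    [/\ differentiable (c \o g) (F x), {for F x, continuous g} &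
      \forall y \near x, g (F y) = y].
Proof.
move=> Ac cx; have [d Ad dx] := atlas_cover X x.
have [U [g [[oU Ux _] [FK _ hgU]]]] := hF x.
have gF y : U y -> g (F y) = y by move=> Uy; apply: FK; rewrite inE.
have FUx : (F @` U) (F x) by exists x.
have [g_cont hg] := hgU _ FUx.
exists g; split => //; last first.
  have nU : \forall y \near x, U y by exact: open_nbhs_nbhs.
  by apply: filterS nU => y /gF.
have dg : differentiable (d \o g) (F x).
  have := hg (standard_chart R n) d erefl Ad Logic.I.
  by rewrite /= gF// => /(_ dx).
apply: (@near_eq_differentiable _ _ _ ((c \o chart_inv d) \o (d \o g))).
  have : \forall z \near F x, chart_dom d (g z).
    apply: g_cont; rewrite gF//.
    by apply: open_nbhs_nbhs; split => //; exact: chart_dom_open.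
  by apply: filterS => z dz /=; rewrite chart_mapK.
apply: differentiable_comp; first exact: dg.
have -> : (d \o g) (F x) = d x by rewrite /= gF.
apply: (Ac _ Ad).2; first exact: chart_map_cod.
by rewrite chart_mapK.
Qed.

(** The biholomorphism [g] from C to the fiber becomes [e] after an affine change of variable that
    sends 0 to [a] and makes the derivative of the line parameter [eta] equal to 1. This derivative
    is not 0 because a local inverse of [F] provides a left inverse [psi] of [eta]. *)
Lemma fiber_coordinate_exists a (v : 'rV[C]_n)
    (hl : complex_line [set F a + t *: v | t in [set: C]]) : v != 0 ->
  biholomorphic (submanifold_structure (preimage_line_submanifold hF hl))
    (complex_space R 1) ->
  exists e c k, fiber_coordinate F a v e c k.
Proof.
set l := [set F a + t *: v | t in [set: C]].
move=> v0 [f [g [fK gK hf hg]]].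
have la : (F @^-1` l) a by exists 0 => //; rewrite scale0r addr0.
pose sa : set_type (F @^-1` l) := SigSub (mem_set la).
have val_sa : set_val sa = a by [].
pose t0 := f sa.
have [i vi] : exists i, v 0 i != 0.
  by move/rV0Pn : v0.
(* A nonzero entry of [v] serves to read off the parameter on the line. *)
pose eta (w : 'rV[C]_1) : C := (F (set_val (g w)) - F a) 0 i / v 0 i.
have F_eta w : F (set_val (g w)) = F a + eta w *: v.
  have [t _ tE] := set_valP (g w).
  rewrite /eta -tE addrAC subrr add0r mxE mulfK//.
have eta0 : eta t0 = 0 by rewrite /eta /t0 fK val_sa subrr mxE mul0r.
have g_cont : continuous g by move=> w; exact: (hg w Logic.I).1.
have f_cont : continuous f by move=> s; exact: (hf s Logic.I).1.
have val_cont : continuous (set_val : set_type (F @^-1` l) -> X).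
  exact: initial_continuous.
have Fg_cont : continuous (fun w => F (set_val (g w))).
  move=> w; apply: (@continuous_comp _ _ _ (fun w => set_val (g w)) F); last first.
    exact: local_biholomorphism_continuous.
  by apply: continuous_comp; [exact: g_cont|exact: val_cont].
have [ch ech ch_sa] :=
  atlas_cover (submanifold_structure (preimage_line_submanifold hF hl)) sa.
have [c0 [Ac0 _ [domE mapE]]] := ech.
have c0a : chart_dom c0 a by move: ch_sa; rewrite domE.
have n_ch : \forall w \near t0, chart_dom ch (g w).
  apply: g_cont; rewrite fK; apply: open_nbhs_nbhs; split => //.
  exact: chart_dom_open.
have d_chg : differentiable (ch \o g) t0.
  have [_ /(_ (standard_chart R 1) ch erefl ech Logic.I)] := hg t0 Logic.I.
  by rewrite fK => /(_ ch_sa).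
have d_fch : differentiable (f \o chart_inv ch) (ch sa).
  by have [_ /(_ ch (standard_chart R 1) ech erefl ch_sa Logic.I)] := hf sa Logic.I.
pose up (w : 'rV[C]_1) := w *m (pid_mx 1 : 'M[C]_(1, n)).
pose down (w : 'rV[C]_n) := w *m (pid_mx 1 : 'M[C]_(n, 1)).
have upK w : down (up w) = w by exact: (pid_mxK (preimage_line_submanifold hF hl)).
have c0aE : c0 a = up (ch sa) by exact: (mapE _ ch_sa).
have d_Phi : differentiable (fun w => F (set_val (g w))) t0.
  apply: (@near_eq_differentiable _ _ _ ((F \o chart_inv c0) \o up \o (ch \o g))).
    apply: filterS n_ch => w ww /=.
    by rewrite /up -(mapE _ ww) chart_mapK//; move: ww; rewrite domE.
  apply: differentiable_comp; first exact: d_chg.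
  apply: differentiable_comp; first exact: differentiable_mulmxr.
  have -> : up ((ch \o g) t0) = c0 a by rewrite /= fK c0aE.
  exact: differentiable_chart_inv.
have [G [d_G G_cont GF]] := differentiable_local_inverse Ac0 c0a.
(* From the line to [X] by the local inverse [G], through the slice chart to the fiber, and back to
   C by [f]. *)
pose psi (y : C) : 'rV[C]_1 := f (chart_inv ch (down (c0 (G (F a + y *: v))))).
have d_psi : differentiable psi (eta t0).
  rewrite eta0.
  have d_aff : differentiable (fun y : C => F a + y *: v) 0.
    exact: affine_differentiable.
  have -> : psi = (f \o chart_inv ch) \o down \o (c0 \o G) \o
    (fun y : C => F a + y *: v) by [].
  have aff0 : F a + (0 : C) *: v = F a by rewrite scale0r addr0.
  have down0 : down ((c0 \o G) (F a)) = ch sa.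
    by rewrite /= (nbhs_singleton GF) c0aE; exact: upK.
  apply: differentiable_comp; first exact: d_aff.
  rewrite aff0; apply: differentiable_comp; first exact: d_G.
  apply: differentiable_comp; first exact: differentiable_mulmxr.
  by rewrite down0; exact: d_fch.
have psiK : \forall w \near t0, psi (eta w) = w.
  have n1 : \forall w \near t0, G (F (set_val (g w))) = set_val (g w).
    have cc : {for t0, continuous (fun w => set_val (g w))}.
      by apply: continuous_comp; [exact: g_cont|exact: val_cont].
    apply: (cc [set y | G (F y) = y]).
    change (nbhs (set_val (g t0)) [set y | G (F y) = y]).
    have -> : set_val (g t0) = a by rewrite /t0 fK.
    exact: GF.
  apply: filterS2 n1 n_ch => w Gw chw.
  by rewrite /psi -F_eta Gw (mapE _ chw) [down _]upK chart_mapK// gK.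
have d_eta : differentiable eta t0 by exact: coordinate_differentiable d_Phi.
have one0 : const_mx 1 != 0 :> 'rV[C]_1.
  by apply/eqP => /matrixP/(_ 0 0)/eqP; rewrite !mxE oner_eq0.
have [d d0 lim] := normalized_derivative one0 d_eta d_psi psiK.
rewrite eta0 in lim.
pose w1 : 'rV[C]_1 := d *: const_mx 1.
have w10 : w1 0 0 = d by rewrite !mxE mulr1.
pose line (t : C) : 'rV[C]_1 := t *: w1 + t0.
have line_cont : continuous line by exact: affine_continuous.
pose e (t : C) : X := set_val (g (line t)).
(* Off the fiber [q] takes the default value [a]; only its values on the fiber matter. *)
pose q (x : X) : set_type (F @^-1` l) := insubd sa x.
pose c (x : X) : C := (f (q x) - t0) 0 0 / d.
pose k (t : C) : C := if t == 0 then 1 else t^-1 * (eta (line t) - 0).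
have hE t : t * k t = eta (line t).
  rewrite /k; case: eqVneq => [->|tn0].
    by rewrite mul0r /line scale0r add0r eta0.
  by rewrite subr0 mulVKf.
have q_val x y : F x = F a + y *: v -> set_val (q x) = x.
  by move=> Fx; rewrite set_valE insubdK// inE; exists y.
have line_c x : line (c x) = f (q x).
  apply/rowP => j; rewrite (ord1 j) /line /c !mxE mulr1 divfK//.
  by rewrite subrK.
exists e, c, k; split; split.
- by rewrite /e /line scale0r add0r fK.
- move=> t; apply: (@continuous_comp _ _ _ line (fun w => set_val (g w))).
    exact: line_cont.
  by apply: continuous_comp; [exact: g_cont|exact: val_cont].
- by move=> t; rewrite hE /e F_eta.
- move=> t; rewrite /c /e /q set_valE valKd gK /line addrK.
  by rewrite !mxE mulr1 mulfK.
- by move=> x y Fx; rewrite /e line_c fK; exact: q_val Fx.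
- move=> x y O Fx nO.
  have cc : {for q x, continuous (fun s => (f s - t0) 0 0 / d)}.
    by apply: coordinate_continuous; exact: f_cont.
  have [_ [[V oV <-] /= Vq VO]] := cc O nO.
  have nV : \forall x' \near x, V x'.
    by apply: open_nbhs_nbhs; split => //; rewrite -(q_val x y Fx).
  apply: filterS nV => x' Vx' [y' Fx']; apply: (VO (q x')).
  by rewrite /= (q_val x' y' Fx').
- rewrite (_ : (fun t => t * k t) = eta \o line); last by apply/funext => t; rewrite hE.
  move=> t; apply: continuous_comp; first exact: line_cont.
  by apply: coordinate_continuous; exact: Fg_cont.
- exact: continuous_extend lim.
- by rewrite /k eqxx.
Qed.

End LocalBiholomorphism.

(** Scaling the direction by [mu] divides the coordinate by [mu]. From one coordinate this produces
    a homogeneous family over all directions of a line. *)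
Lemma fiber_coordinate_scale (R : realType) (X : topologicalType)
    (Y : normedModType R[i]) (F : X -> Y) a v e c k (mu : R[i]) : mu != 0 ->
  fiber_coordinate F a v e c k ->
  fiber_coordinate F a (mu *: v) (fun t => e (mu * t)) (fun x => c x / mu)
    (fun t => k (mu * t)).
Proof.
move=> mu0 [[e0 e_cont Fe eK cK] [c_cont h_cont k_cont k0]].
have mul_cont : continuous (fun t : R[i] => mu * t).
  move=> t; apply: continuous_atM; first exact: continuous_at_cst.
  exact: cvg_id.
have hE (t : R[i]) : t * k (mu * t) = mu^-1 * (mu * t * k (mu * t)).
  by rewrite !mulrA mulVf// mul1r.
split; split.
- by rewrite mulr0.
- by move=> t; apply: (@continuous_comp _ _ _ (fun t : R[i] => mu * t) e);
    [exact: mul_cont|exact: e_cont].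
- by move=> t; rewrite Fe scalerA [in RHS]mulrC mulrA.
- by move=> t; rewrite eK mulrC mulKf.
- move=> x y; rewrite scalerA => /cK; rewrite mulrCA divff// mulr1.
  by [].
- move=> x y O; rewrite scalerA => Fx nO.
  have cc : {for c x, continuous (fun z : R[i] => z / mu)}.
    by apply: continuous_atM; [exact: cvg_id|exact: continuous_at_cst].
  apply: filterS (c_cont x _ [set z | O (z / mu)] Fx (cc O nO)) => x' Ox' [y' Fx'].
  by apply: Ox'; exists (y' * mu); rewrite -scalerA.
- rewrite (_ : (fun t => _) = (fun t : R[i] => mu^-1 * (mu * t * k (mu * t)))); last first.
    by apply/funext => t; exact: hE.
  move=> t.
  apply: (@continuous_atM R[i] R[i] (fun _ => mu^-1) (fun t => mu * t * k (mu * t))).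
    exact: continuous_at_cst.
  apply: (@continuous_comp _ _ _ (fun t : R[i] => mu * t) (fun t => t * k t)).
    exact: mul_cont.
  exact: h_cont.
- apply: (@continuous_comp _ _ _ (fun t : R[i] => mu * t) k); first exact: mul_cont.
  by rewrite mulr0; exact: k_cont.
- by rewrite mulr0.
Qed.

(** * The family of directions *)

Unset Implicit Arguments.

Theorem corollary1p2 (R : realType) (n : nat) (hn : (2 <= n)%N)
    (X : complex_manifold R n) (F : X -> 'rV[R[i]]_n)
    (hF : local_biholomorphism X (complex_space R n) F)
    (hlines : forall (l : set 'rV[R[i]]_n) (hl : complex_line l),
      F @^-1` l !=set0 ->
      connected (F @^-1` l) /\
      biholomorphic
        (submanifold_structure (preimage_line_submanifold hF hl))
        (complex_space R 1)) :
  injective F.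
Proof.
move=> a b Fab; apply/eqP; apply/negPn/negP => ab.
(* The condition on [w] sits under the existentials, so that choice yields total functions. *)
have coords_ex (w : 'rV[R[i]]_n) : exists e c k, w != 0 ->
    fiber_coordinate F a w e c k.
  have [w0|w0] := pselect (w != 0); last first.
    by exists (fun=> a), (fun=> 0), (fun=> 0) => /w0.
  have hl : complex_line [set F a + t *: w | t in [set: R[i]]].
    by exists (F a), w.
  have [|_ hb] := hlines _ hl.
    by exists a, 0 => //; rewrite scale0r addr0.
  have [e [c [k h]]] := fiber_coordinate_exists w0 hb.
  by exists e, c, k.
have /choice[e0 /choice[c0 /choice[k0 coord0]]] := coords_ex.
(* Two independent directions exist since [n] is at least 2. *)
pose i0 : 'I_n := Ordinal (ltnW hn); pose i1 : 'I_n := Ordinal hn.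
pose w1 : 'rV[R[i]]_n := delta_mx 0 i1.
(* [bump p = 2 * max 0 (1 - `|p|)] *)
pose bump (p : R * R) : R := `|1 - `|p| | + (1 - `|p|).
pose v (p : R * R) : 'rV[R[i]]_n :=
  plane (bump p, 0) *: delta_mx 0 i0 + plane p *: w1.
have i01 : (i0 == i1) = false by [].
have w10 : w1 != 0.
  by apply/eqP => /matrixP/(_ 0 i1)/eqP; rewrite !mxE !eqxx oner_eq0.
have bump_far (p : R * R) : 1 <= `|p| -> bump p = 0.
  by move=> p1; rewrite /bump distrC ger0_norm ?subr_ge0//; ring.
have v_far (p : R * R) : 1 <= `|p| -> v p = plane p *: w1.
  by move=> p1; rewrite /v bump_far// scale0r add0r.
have plane_far (p : R * R) : 1 <= `|p| -> plane p != 0 by exact: ge1_plane_neq0.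
have v_neq0 p : v p != 0.
  have [/[dup]p1 /v_far ->|p1] := leP 1 `|p|.
    by rewrite scaler_eq0 negb_or plane_far.
  apply/eqP => /matrixP/(_ 0 i0)/eqP; rewrite !mxE !eqxx i01 mulr1 mulr0 addr0.
  rewrite plane_eq0 => /eqP[] /eqP.
  rewrite /bump ger0_norm ?subr_ge0 ?ltW// -mulr2n mulrn_eq0/= subr_eq0 => /eqP p1'.
  by rewrite -p1' ltxx in p1.
have v_cont : continuous v.
  have bump_cont : continuous bump.
    move=> p; have dist_cont : {for p, continuous (fun q : R * R => 1 - `|q|)}.
      by apply: cvgB; [exact: cvg_cst|exact: norm_continuous].
    apply: (@continuous_atD R (R * R)%type R (fun q => `|1 - `|q| |) (fun q => 1 - `|q|)).
      exact: cvg_norm dist_cont.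
    exact: dist_cont.
  move=> p; apply: (@continuous_atD R[i] (R * R)%type 'rV[R[i]]_n
    (fun q => plane (bump q, 0) *: delta_mx 0 i0) (fun q => plane q *: w1)).
    apply: continuous_atZ; last exact: continuous_at_cst.
    apply: (@continuous_comp _ _ _ (fun q => (bump q, 0)) (@plane R)).
      exact: (cvg_pair (@bump_cont p) (@continuous_at_cst _ _ (0 : R) p)).
    exact: plane_continuous.
  apply: continuous_atZ; last exact: continuous_at_cst.
  exact: plane_continuous.
pose far (p : R * R) := 1 <= `|p|.
(* Far out all coordinates are rescaled from the single choice over [w1], as homogeneity demands;
   inside they are chosen independently of each other. *)
pose e p t := if far p then e0 w1 (plane p * t) else e0 (v p) t.
pose c p x := if far p then c0 w1 x / plane p else c0 (v p) x.
pose k p t := if far p then k0 w1 (plane p * t) else k0 (v p) t.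
have coordE p : fiber_coordinate F a (v p) (e p) (c p) (k p).
  rewrite /e /c /k; case: (boolP (far p)) => p1; last exact: coord0.
  by rewrite v_far//; apply: fiber_coordinate_scale; [exact: plane_far|exact: coord0].
refine (no_fiber_coordinate_family (@manifold_hausdorff _ _ X)
  (local_biholomorphism_open hF)
  (local_biholomorphism_inj hF) ab Fab v_cont v_neq0 coordE _).
move=> p p' p1 p1'.
have [n1 n2] := (plane_far p p1, plane_far p' p1').
split.
- by rewrite !v_far// scalerA divfK.
- by move=> x; rewrite /c /far p1 p1' mulrA divfK.
- by move=> t; rewrite /k /far p1 p1' mulrA mulrCA divff ?mulr1.
Qed.
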